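(* Let $(S,0)$ be an analytically irreducible quasi-ordinary hypersurface germ of dimension $d\ge1$, with associated semigroup $\Gamma$, and let $S_0=(Z^\Gamma,0)\subset(\mathbb{C}^{d+g},0)$ be its associated monomial variety, with normalization $Z$. Then $$\mathrm{Jac}(S_0)\,\mathcal{O}_Z=X^{\gamma_0}\cdot\mathcal{J}_{\mathrm{log}}(S_0)\,\mathcal{O}_Z=X^{\gamma_0}\cdot\mathcal{I}_g .$$
   Context: Quasi-ordinary data. Let $X=(X_1,\dots,X_d)$. A Weierstrass polynomial $f\in\mathbb{C}\{X\}[Y]$ is quasi-ordinary if its discriminant with respect to $Y$ is $X^\delta\epsilon$ with $\delta\in\mathbb{Z}_{\ge0}^d$ and $\epsilon$ a unit of $\mathbb{C}\{X\}$. Let $f$ be irreducible quasi-ordinary of degree $n$, defining $(S,0)\subset(\mathbb{C}^{d+1},0)$. Its roots lie in $\mathbb{C}\{X_1^{1/n},\dots,X_d^{1/n}\}$. The difference of two distinct roots is $X^{\lambda}$ times a unit; the exponents $\lambda\in\frac1n\mathbb{Z}_{\ge0}^d$ so obtained are the characteristic exponents, and (Lipman) they can be labelled $\lambda_1\prec\cdots\prec\lambda_g$, where $\gamma\prec\gamma'$ means $\gamma'-\gamma\in\mathbb{R}^d_{\ge0}$ and $\gamma\ne\gamma'$. Let $e_1,\dots,e_d$ be the canonical basis of $M_0=\mathbb{Z}^d$, $M_j=M_{j-1}+\mathbb{Z}\lambda_j$, $M=M_g$, $n_j=[M_j:M_{j-1}]$, $\sigma^\vee=\mathbb{R}^d_{\ge0}$.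 Put $\overline\lambda_1=\lambda_1$, $\overline\lambda_{j+1}=n_j\overline\lambda_j+\lambda_{j+1}-\lambda_j$. $\Gamma\subset\sigma^\vee\cap M$ is the semigroup generated by $\gamma_1,\dots,\gamma_{d+g}:=e_1,\dots,e_d,\overline\lambda_1,\dots,\overline\lambda_g$. There are uniquely determined relations $n_j\overline\lambda_j=\sum_{i=1}^{d}\ell_i^{(j)}e_i+\sum_{k=1}^{j-1}\ell_{d+k}^{(j)}\overline\lambda_k$ with $\ell_i^{(j)}\in\mathbb{Z}_{\ge0}$ for $i\le d$ and $0\le \ell_{d+k}^{(j)}<n_k$. Put $\gamma_0=\sum_{j=1}^g(n_j-1)\overline\lambda_j-\sum_{i=1}^d e_i$ (the minimal Frobenius vector of $\Gamma$). $Z^\Gamma=\mathrm{Spec}\,\mathbb{C}[\Gamma]$ is embedded in $\mathbb{C}^{d+g}$ by $U_i=X^{\gamma_i}$, and its ideal is generated by $h_j=U_1^{\ell_1^{(j)}}\cdots U_{d+j-1}^{\ell_{d+j-1}^{(j)}}-U_{d+j}^{n_j}$, $j=1,\dots,g$. The normalization $Z$ of its germ at $0$ has local ring $\mathcal{O}_Z=\mathbb{C}\{\sigma^\vee\cap M\}$ (convergent power series with exponents in $\sigma^\vee\cap M$). $\mathrm{Jac}(S_0)\mathcal{O}_Z$ is the ideal of $\mathcal{O}_Z$ generated by the images under $U_i\mapsto X^{\gamma_i}$ of the $g\times g$ minors of $(\partial h_j/\partial U_i)$. $\mathcal{I}_g$ is the ideal of $\mathcal{O}_Z$ generated by the monomials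 $X^{\gamma_{i_1}+\cdots+\gamma_{i_d}}$ with $1\le i_1<\cdots<i_d\le d+g$ and $\gamma_{i_1}\wedge\cdots\wedge\gamma_{i_d}\ne0$. Logarithmic Jacobian ideal. For an analytically irreducible germ $W$ of dimension $d$ with normalization $Z$, let $\Omega^1_W$ be the module of (analytic) Kähler differentials and $\Omega^d_W=\bigwedge^d\Omega_W^1$. Let $\eta:\Omega^1_Z\to\mathcal{O}_Z\otimes_{\mathbb{Z}}M$ be the $\mathcal{O}_Z$-linear map with $d(\sum c_\gamma X^\gamma)\mapsto\sum c_\gamma X^\gamma\otimes\gamma$. With $\bigwedge^dM\cong\mathbb{Z}$ (choice of a basis of $M$), $\mathcal{J}_{\mathrm{log}}(W)\mathcal{O}_Z$ is the ideal of $\mathcal{O}_Z$ generated by the image of $\Omega^d_W\to\Omega^d_Z\xrightarrow{\wedge^d\eta}\mathcal{O}_Z\otimes\bigwedge^dM\cong\mathcal{O}_Z$. Products with $X^{\gamma_0}$ are taken in the fraction field of $\mathcal{O}_Z$. *)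

(* Defs.v *)
From HB Require Import structures.
From mathcomp Require Import all_boot all_order all_algebra fraction.
From mathcomp Require Import generic_quotient ring_quotient complex.
From mathcomp Require Import finmap mpoly monalg.
From mathcomp Require Import boolp classical_sets functions cardinality fsbigop.
From mathcomp Require Import reals sequences exp.

Set Implicit Arguments.
Unset Strict Implicit.
Unset Printing Implicit Defensive.

Import Order.TTheory GRing.Theory Num.Theory.

Local Open Scope classical_set_scope.
Local Open Scope ring_scope.

Section Exponents.
Variable d : nat.
Implicit Types g : 'rV[rat]_d.

(* [frac_exps k] is (1/k) Z_{>=0}^d. *)
Definition frac_exps (k : nat) : set 'rV[rat]_d :=
  [set g | forall i, exists m : nat, g 0 i = m%:R / k%:R].

Definition deg g : rat := \sum_i g 0 i.

Lemma degD g h : deg (g + h) = deg g + deg h.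
Proof.
by rewrite /deg -big_split /=; apply: eq_bigr => i _; rewrite mxE.
Qed.

Lemma frac_exps_ge0 k g i : frac_exps k g -> 0 <= g 0 i.
Proof. by move=> /(_ i)[m ->]; rewrite divr_ge0 ?ler0n. Qed.

Lemma deg_ge0 k g : frac_exps k g -> 0 <= deg g.
Proof. by move=> kg; apply: sumr_ge0 => i _; exact: frac_exps_ge0 kg. Qed.

Lemma frac_exps0 k : frac_exps k 0.
Proof. by move=> i; exists 0%N; rewrite mxE mul0r. Qed.

Lemma frac_expsD k g h : frac_exps k g -> frac_exps k h -> frac_exps k (g + h).
Proof.
move=> gk hk i; have [m gm] := gk i; have [n hn] := hk i.
by exists (m + n)%N; rewrite mxE gm hn natrD mulrDl.
Qed.

Lemma frac_exps_mul k l g : (0 < k)%N -> (0 < l)%N -> frac_exps k g -> frac_exps (k * l) g.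
Proof.
move=> k0 l0 gk i; have [m ->] := gk i; exists (m * l)%N.
by rewrite !natrM -mulf_div divff ?mulr1// pnatr_eq0 -lt0n.
Qed.

Lemma finite_box k g : (0 < k)%N ->
  finite_set [set a | frac_exps k a /\ forall i, a 0 i <= g 0 i].
Proof.
move=> k0; pose B := (\sum_i `|numq (g 0%R i)| * k)%N.
pose e (f : {ffun 'I_d -> 'I_B.+1}) : 'rV[rat]_d := \row_i ((f i : nat)%:R / k%:R).
apply: (@sub_finite_set _ _ (e @` setT)); last exact/finite_image/finite_finset.
move=> a [ak ag].
have /choice[m am] : forall i, exists m : nat, a 0 i = m%:R / k%:R by [].
have mB i : (m i < B.+1)%N.
  rewrite ltnS; have := ag i; rewrite am => le1.
  have kp : (0 : rat) < k%:R by rewrite ltr0n.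
  have : (m i)%:R <= (`|numq (g 0%R i)| * k)%N%:R :> rat.
    rewrite natrM -ler_pdivrMr//; apply: (le_trans le1).
    rewrite -[g 0 i]divq_num_den ler_pdivrMr ?ltr0z ?denq_gt0//.
    rewrite divq_num_den pmulrn abszE.
    apply: le_trans (ler_norm _) _; rewrite -intr_norm.
    by rewrite ler_peMr ?ler0z// ler1z -gtz0_ge1 denq_gt0.
  rewrite ler_nat => /leq_trans; apply.
  by rewrite /B (bigD1 i)//= leq_addr.
exists [ffun i => Ordinal (mB i)] => //.
by apply/rowP => i; rewrite mxE ffunE /= -am.
Qed.

End Exponents.

Section Puiseux.
Variables (R : realType) (d : nat).
Local Notation C := R[i].
Local Notation Q := 'rV[rat]_d.
Local Notation normc := Normc.normc.
Implicit Types (f g h : Q -> C) (a b c : Q).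

(* Convergent fractional power series in X_1, ..., X_d: a function giving the
   coefficient of each X^a. The exponents lie in (1/k) Z_{>=0}^d for some k
   depending on the series, and sum_a |f_a| r^(a_1 + ... + a_d) converges for
   some r > 0; so these series form the union over k of the rings
   C{X_1^(1/k), ..., X_d^(1/k)}. *)
Definition puiseux f : Prop :=
  (exists2 k, (0 < k)%N & forall a, f a != 0 -> frac_exps k a) /\
  (exists2 r : R, 0 < r & exists K : R, forall s : seq Q, uniq s ->
     \sum_(a <- s) normc (f a) * r `^ ratr (deg a) <= K).

Definition is_puiseux : {pred Q -> C} := fun f => `[< puiseux f >].

Definition pmul f g : Q -> C :=
  fun a => \sum_(b \in [set: Q]) f b * g (a - b).

Definition pone : Q -> C := fun a => (a == 0)%:R.

Lemma normc_ge0 (z : C) : 0 <= normc z.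
Proof. by case: z => x y; rewrite sqrtr_ge0. Qed.

Lemma normc_sum (I : Type) (s : seq I) (F : I -> C) :
  normc (\sum_(i <- s) F i) <= \sum_(i <- s) normc (F i).
Proof.
elim/big_rec2: _ => [|i x y _ ih]; first by rewrite Normc.normc0.
by apply: le_trans (le_normcD _ _) _; rewrite lerD2l.
Qed.

Lemma normc_mul (x y : C) : normc (x * y) = normc x * normc y.
Proof. exact: Normc.normcM. Qed.

Lemma puiseux_common2 f g : puiseux f -> puiseux g ->
  exists k, [/\ (0 < k)%N, forall a, f a != 0 -> frac_exps k a
    & forall a, g a != 0 -> frac_exps k a].
Proof.
move=> [[k k0 fk] _] [[l l0 gl] _]; exists (k * l)%N; split.
- by rewrite muln_gt0 k0.
- by move=> a /fk; exact: frac_exps_mul.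
- by move=> a /gl; rewrite mulnC; exact: frac_exps_mul.
Qed.

Lemma puiseux_deg_ge0 f a : puiseux f -> f a != 0 -> 0 <= deg a.
Proof. by move=> [[k k0 fk] _] /fk; exact: deg_ge0. Qed.

Lemma puiseux_radius f r r' (K : R) : puiseux f -> 0 < r' -> r' <= r ->
  (forall s : seq Q, uniq s ->
     \sum_(a <- s) normc (f a) * r `^ ratr (deg a) <= K) ->
  (forall s : seq Q, uniq s ->
     \sum_(a <- s) normc (f a) * r' `^ ratr (deg a) <= K).
Proof.
move=> fp r'0 r'r H s us; apply: le_trans (H s us); apply: ler_sum => a _.
have [->|fa0] := eqVneq (f a) 0; first by rewrite Normc.normc0 !mul0r.
apply: ler_wpM2l; first exact: normc_ge0.
have r0 := lt_le_trans r'0 r'r.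
by apply: ge0_ler_powR; rewrite ?ler0q ?nnegrE ?(ltW r'0) ?(ltW r0)//;
  exact: puiseux_deg_ge0 fa0.
Qed.

Lemma puiseux_radius2 f g : puiseux f -> puiseux g ->
  exists r : R, 0 < r /\ exists K L : R,
  (forall s : seq Q, uniq s ->
     \sum_(a <- s) normc (f a) * r `^ ratr (deg a) <= K) /\
  (forall s : seq Q, uniq s ->
     \sum_(a <- s) normc (g a) * r `^ ratr (deg a) <= L).
Proof.
move=> fp gp; have [_ [r r0 [K Kf]]] := fp; have [_ [t t0 [L Lg]]] := gp.
exists (Num.min r t); split; first by rewrite lt_min r0.
have m0 : 0 < Num.min r t by rewrite lt_min r0.
exists K, L; split.
- by apply: puiseux_radius Kf => //; rewrite ge_min lexx.
- by apply: puiseux_radius Lg => //; rewrite ge_min lexx orbT.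
Qed.

Lemma puiseux_zmod_closed : zmod_closed is_puiseux.
Proof.
split=> [|f g /asboolP fp /asboolP gp]; apply/asboolP.
  split; first by exists 1%N => // a; rewrite eqxx.
  exists 1; rewrite ?ltr01//; exists 0 => s _.
  by rewrite big1// => a _; rewrite Normc.normc0 mul0r.
have [k [k0 fk gk]] := puiseux_common2 fp gp.
have subE x : (f - g) x = f x - g x by [].
split.
  exists k => // a; have [fa0|fa0] := eqVneq (f a) 0; last by move=> _; exact: fk.
  have [ga0|ga0] := eqVneq (g a) 0; last by move=> _; exact: gk.
  by rewrite subE fa0 ga0 subr0 eqxx.
have [r [r0 [K [L [Kf Lg]]]]] := puiseux_radius2 fp gp.
exists r => //; exists (K + L) => s us.
apply: le_trans (lerD (Kf s us) (Lg s us)); rewrite -big_split/=.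
apply: ler_sum => a _; rewrite -mulrDl; apply: ler_wpM2r; first exact: powR_ge0.
rewrite subE; apply: le_trans (le_normcD _ _) _; rewrite lerD2l.
by have -> := @normcN R (g a).
Qed.

Lemma puiseux_one : puiseux pone.
Proof.
split.
  exists 1%N => // a; rewrite /pone; have [-> _|] := eqVneq a 0; last by rewrite eqxx.
  exact: frac_exps0.
exists 1; rewrite ?ltr01//; exists 1 => s us.
rewrite (eq_bigr (fun a => (a == 0)%:R)) => [|a _]; last first.
  rewrite powR1 mulr1 /pone.
  by case: eqP => _; rewrite ?Normc.normc0 ?Normc.normc1.
have [s0|s0] := boolP (0 \in s); last first.
  rewrite big_seq big1 ?ler01// => a sa; case: eqP => // a0.
  by rewrite -a0 sa in s0.
rewrite (bigD1_seq (0 : Q))//= eqxx big1 ?addr0// => a a0.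
by rewrite (negbTE a0).
Qed.

Lemma finite_pair k a : (0 < k)%N ->
  exists A : {fset Q}, forall b, frac_exps k b -> frac_exps k (a - b) -> b \in A.
Proof.
move=> k0; have fin := @finite_box d k a k0.
exists (fset_set [set b | frac_exps k b /\ forall i, b 0 i <= a 0 i]).
move=> b kb kab; rewrite in_fset_set//; apply/mem_set; split=> // i.
by have := frac_exps_ge0 i kab; rewrite !mxE subr_ge0.
Qed.

Lemma pmulE k f g a (A : {fset Q}) :
  (forall b, frac_exps k b -> frac_exps k (a - b) -> b \in A) ->
  (forall a, f a != 0 -> frac_exps k a) ->
  (forall a, g a != 0 -> frac_exps k a) ->
  pmul f g a = \sum_(b <- A) f b * g (a - b).
Proof.
move=> HA fk gk; rewrite /pmul (fsbigTE A)// => b bA.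
have [->|/fk kb] := eqVneq (f b) 0; first by rewrite mul0r.
have [->|/gk kab] := eqVneq (g (a - b)) 0; first by rewrite mulr0.
by rewrite HA in bA.
Qed.

Lemma pmulC f g : pmul f g = pmul g f.
Proof.
apply/funext => a; rewrite /pmul (reindex_fsbigT (fun b => a - b))/=.
  by apply: eq_fsbigr => b _; rewrite mulrC opprB addrC subrK.
by exists (fun b => a - b) => b; rewrite opprB addrC subrK.
Qed.

Lemma pmul_neq0 f g a : pmul f g a != 0 -> exists b, f b != 0 /\ g (a - b) != 0.
Proof.
move=> ne0; apply: contrapT => H; move/eqP: ne0; apply.
rewrite /pmul fsbig1// => b _.
have [->|fb] := eqVneq (f b) 0; first by rewrite mul0r.
have [->|gb] := eqVneq (g (a - b)) 0; first by rewrite mulr0.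
by case: H; exists b.
Qed.

Lemma pmul_frac k f g :
  (forall a, f a != 0 -> frac_exps k a) ->
  (forall a, g a != 0 -> frac_exps k a) ->
  (forall a, pmul f g a != 0 -> frac_exps k a).
Proof.
move=> fk gk a /pmul_neq0[b [/fk fb /gk gb]].
by rewrite -(subrK b a); exact: frac_expsD.
Qed.

Lemma puiseux_mul f g : puiseux f -> puiseux g -> puiseux (pmul f g).
Proof.
move=> fp gp; have [k [k0 fk gk]] := puiseux_common2 fp gp.
split; first by exists k => //; exact: pmul_frac.
have [r [r0 [K [L [Kf Lg]]]]] := puiseux_radius2 fp gp.
exists r => //; exists (K * L) => s us.
have L0 : 0 <= L by have := Lg [::] isT; rewrite big_nil.
have /choice[B BP] : forall a, exists A : {fset Q},
  forall b, frac_exps k b -> frac_exps k (a - b) -> b \in A.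
  by move=> a; exact: finite_pair.
pose A := fset_set (\bigcup_(a in [set` s]) [set` B a]).
have AP a : a \in s -> forall b, frac_exps k b -> frac_exps k (a - b) -> b \in A.
  move=> sa b kb kab; rewrite in_fset_set; last first.
    by apply: bigcup_finite => //= x _; exact: finite_fset.
  by apply/mem_set; exists a => //=; exact: BP.
apply: (@le_trans _ _ (\sum_(a <- s) \sum_(b <- A)
   (normc (f b) * r `^ ratr (deg b)) *
   (normc (g (a - b)) * r `^ ratr (deg (a - b))))).
  rewrite big_seq [leRHS]big_seq; apply: ler_sum => a sa.
  rewrite (pmulE (AP a sa) fk gk).
  apply: (le_trans (ler_wpM2r (powR_ge0 _ _) (normc_sum _ _))).
  rewrite mulr_suml; apply: ler_sum => b _.
  rewrite normc_mul mulrACA -powRD; last by rewrite (gt_eqF r0) implybT.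
  by rewrite -rmorphD -degD (addrC b) subrK.
rewrite exchange_big/=.
apply: (@le_trans _ _ (\sum_(b <- A) (normc (f b) * r `^ ratr (deg b)) * L)).
  apply: ler_sum => b _; rewrite -mulr_sumr.
  apply: ler_wpM2l; first by rewrite mulr_ge0 ?normc_ge0 ?powR_ge0.
  rewrite -(big_map (fun a => a - b) predT
    (fun c => normc (g c) * r `^ ratr (deg c)))/=.
  by apply: Lg; rewrite map_inj_uniq//; exact: addIr.
rewrite -mulr_suml; apply: ler_wpM2r => //.
by apply: Kf; exact: fset_uniq.
Qed.

Lemma pmulA f g h : puiseux f -> puiseux g -> puiseux h ->
  pmul f (pmul g h) = pmul (pmul f g) h.
Proof.
move=> fp gp hp.
have [k [k0 fk gk hk]] : exists k, [/\ (0 < k)%N,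
   forall a, f a != 0 -> frac_exps k a,
   forall a, g a != 0 -> frac_exps k a &
   forall a, h a != 0 -> frac_exps k a].
  have [k [k0 fk gk]] := puiseux_common2 fp gp.
  have [[l l0 hl] _] := hp.
  exists (k * l)%N; split; first by rewrite muln_gt0 k0.
  - by move=> a /fk; exact: frac_exps_mul.
  - by move=> a /gk; exact: frac_exps_mul.
  - by move=> a /hl; rewrite mulnC; exact: frac_exps_mul.
apply/funext => a.
have [A AP] := finite_pair a k0.
rewrite (pmulE AP fk (pmul_frac gk hk)) (pmulE AP (pmul_frac fk gk) hk).
under [RHS]eq_bigr => c _.
  rewrite (_ : pmul f g c * h (a - c) =
               \sum_(b <- A) f b * (g (c - b) * h (a - c))); last first.
    have [->|hc] := eqVneq (h (a - c)) 0.
      by rewrite mulr0 big1// => b _; rewrite !mulr0.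
    have kac := hk _ hc.
    rewrite (@pmulE k _ _ _ A)//; last first.
      move=> b kb kcb; apply: AP => //.
      by rewrite -(subrK c a) -addrA; exact: frac_expsD.
    by rewrite mulr_suml; apply: eq_bigr => b _; rewrite mulrA.
  over.
rewrite exchange_big/=; apply: eq_bigr => b _; rewrite -mulr_sumr.
have [->|/fk fb] := eqVneq (f b) 0; first by rewrite !mul0r.
congr (_ * _).
rewrite /pmul (reindex_fsbigT (fun c => c - b))/=; last first.
  by exists (fun c => c + b) => c; rewrite ?subrK ?addrK.
rewrite (fsbigTE A); last first.
  move=> c cA; have [->|/gk gc] := eqVneq (g (c - b)) 0; first by rewrite mul0r.
  have [->|/hk hc] := eqVneq (h (a - b - (c - b))) 0; first by rewrite mulr0.
  rewrite AP// in cA; first by rewrite -(subrK b c); exact: frac_expsD.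
  by rewrite (_ : a - c = a - b - (c - b))// opprB addrA subrK.
by apply: eq_bigr => c _; rewrite opprB addrA subrK.
Qed.

Lemma pmul1 f : pmul pone f = f.
Proof.
apply/funext => a; rewrite /pmul (fsbigTE [fset 0]%fset).
  by rewrite big_seq_fset1 /pone eqxx mul1r subr0.
by move=> b; rewrite in_fset1 /pone => /negbTE ->; rewrite mul0r.
Qed.

Lemma pmulDl f g h : puiseux f -> puiseux g -> puiseux h ->
  pmul (f + g) h = pmul f h + pmul g h.
Proof.
move=> fp gp hp.
have [k [k0 fk gk]] := puiseux_common2 fp gp.
have [[l l0 hl] _] := hp.
have kl0 : (0 < k * l)%N by rewrite muln_gt0 k0.
apply/funext => a; have [A AP] := finite_pair a kl0.
have Fk b : f b != 0 -> frac_exps (k * l) b by move=> /fk; exact: frac_exps_mul.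
have Gk b : g b != 0 -> frac_exps (k * l) b by move=> /gk; exact: frac_exps_mul.
have Hk b : h b != 0 -> frac_exps (k * l) b.
  by move=> /hl; rewrite mulnC; exact: frac_exps_mul.
have addE (u v : Q -> C) x : (u + v) x = u x + v x by [].
rewrite addE (pmulE AP Fk Hk) (pmulE AP Gk Hk).
rewrite (pmulE AP _ Hk); last first.
  move=> b; have [fb|fb _] := eqVneq (f b) 0; last exact: Fk.
  by rewrite addE fb add0r; exact: Gk.
by rewrite -big_split/=; apply: eq_bigr => b _; rewrite addE mulrDl.
Qed.

End Puiseux.

Section LexMin.
Variable d : nat.
Implicit Types (a b c : 'rV[rat]_d) (A : set 'rV[rat]_d).

Definition lexlt a b := exists i : 'I_d,
  (forall j : 'I_d, (j < i)%N -> a 0 j = b 0 j) /\ a 0 i < b 0 i.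

Lemma lexlt_add a b a' b' : lexlt a a' -> lexlt b b' -> a + b <> a' + b'.
Proof.
move=> [i [ilt ai]] [j [jlt bj]] E.
have [ij|ji|/val_inj ij] := ltngtP i j.
- have := congr1 (fun c => c 0 i) E; rewrite !mxE jlt// => /addIr e.
  by rewrite e ltxx in ai.
- have := congr1 (fun c => c 0 j) E; rewrite !mxE ilt// => /addrI e.
  by rewrite e ltxx in bj.
- subst j; have := congr1 (fun c => c 0 i) E; rewrite !mxE => e.
  by have := ltrD ai bj; rewrite e ltxx.
Qed.

Lemma lexmin k A : (0 < k)%N -> A `<=` frac_exps k -> A !=set0 ->
  exists2 a, A a & forall b, A b -> b <> a -> lexlt a b.
Proof.
move=> k0 Ak A0.
suff H n : (n <= d)%N -> exists2 a, A a & forall b, A b ->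
    (forall i : 'I_d, (i < n)%N -> b 0 i = a 0 i) \/
    exists i : 'I_d, [/\ (i < n)%N, forall j : 'I_d, (j < i)%N -> a 0 j = b 0 j
                       & a 0 i < b 0 i].
  have [a Aa aP] := H d (leqnn d); exists a => // b Ab ba.
  have [E|[i [_ ilt ai]]] := aP b Ab; last by exists i.
  by exfalso; apply: ba; apply/rowP => i; exact: E.
elim: n => [_|n ih nd].
  by case: A0 => a Aa; exists a => // b Ab; left.
have [a Aa aP] := ih (ltnW nd); pose i0 := Ordinal nd.
pose P m := `[< exists2 b, A b /\ (forall i : 'I_d, (i < n)%N -> b 0 i = a 0 i)
                 & b 0 i0 = m%:R / k%:R >].
have exP : exists m, P m.
  by have [m am] := Ak a Aa i0; exists m; apply/asboolP; exists a.
case: (ex_minnP exP) => m /asboolP[c [Ac ca] cm] mmin.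
exists c => // b Ab.
have [ba|[i [ni ilt ai]]] := aP b Ab; last first.
  right; exists i; split; [exact: ltnW| |by rewrite ca].
  by move=> j ji; rewrite ca ?ilt//; exact: ltn_trans ni.
have [l bl] := Ak b Ab i0.
have : (m <= l)%N by apply: mmin; apply/asboolP; exists b.
rewrite leq_eqVlt => /orP[/eqP ml|ml]; [left|right].
  move=> i; rewrite ltnS leq_eqVlt => /orP[/eqP ni|ni]; last by rewrite ba ?ca.
  by rewrite (_ : i = i0) ?bl ?cm ?ml//; exact: val_inj.
exists i0; split=> //=; first by move=> j jn; rewrite ba ?ca.
by rewrite bl cm ltr_pM2r ?invr_gt0 ?ltr0n// ltr_nat.
Qed.

End LexMin.

Section PuiseuxRing.
Variables (R : realType) (d : nat).
Local Notation C := R[i].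
Local Notation Q := 'rV[rat]_d.

Record pser := PSer { coef :> Q -> C; _ : is_puiseux coef }.

HB.instance Definition _ := [isSub for coef].
HB.instance Definition _ := [Choice of pser by <:].
HB.instance Definition _ :=
  GRing.isZmodClosed.Build (Q -> C) (@is_puiseux R d) (@puiseux_zmod_closed R d).
HB.instance Definition _ := [SubChoice_isSubZmodule of pser by <:].

Lemma pserP (f g : pser) : (forall a, coef f a = coef g a) -> f = g.
Proof. by move=> fg; apply/val_inj/funext. Qed.

Lemma pser_puiseux (f : pser) : puiseux (coef f).
Proof. by case: f => f fp; apply/asboolP. Qed.

Definition pser_one := @PSer (@pone R d) (asboolT (puiseux_one R d)).
Definition pser_mul (f g : pser) := @PSer (pmul f g)
  (asboolT (puiseux_mul (pser_puiseux f) (pser_puiseux g))).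

Lemma pser_mulA : associative pser_mul.
Proof. by move=> f g h; apply/val_inj/pmulA; exact: pser_puiseux. Qed.
Lemma pser_mulC : commutative pser_mul.
Proof. by move=> f g; apply/val_inj/pmulC. Qed.
Lemma pser_mul1 : left_id pser_one pser_mul.
Proof. by move=> f; apply/val_inj/pmul1. Qed.
Lemma pser_mulDl : left_distributive pser_mul +%R.
Proof. by move=> f g h; apply/val_inj/pmulDl; exact: pser_puiseux. Qed.
Lemma pser_one_neq0 : pser_one != 0.
Proof.
apply/eqP => /(congr1 (fun f => coef f 0)); rewrite /= /pone eqxx.
exact/eqP/oner_neq0.
Qed.

HB.instance Definition _ := GRing.Zmodule_isComNzRing.Build pser
  pser_mulA pser_mulC pser_mul1 pser_mulDl pser_one_neq0.

Lemma coef0 a : coef 0 a = 0. Proof. by []. Qed.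
Lemma coef1 a : coef 1 a = (a == 0)%:R. Proof. by []. Qed.
Lemma coefD (f g : pser) a : coef (f + g) a = f a + g a. Proof. by []. Qed.
Lemma coefN (f : pser) a : coef (- f) a = - f a. Proof. by []. Qed.
Lemma coefB (f g : pser) a : coef (f - g) a = f a - g a. Proof. by []. Qed.
Lemma coefM (f g : pser) a :
  coef (f * g) a = \sum_(b \in [set: Q]) f b * g (a - b).
Proof. by []. Qed.

Lemma pser_mul_eq0 (f g : pser) : f * g = 0 -> f = 0 \/ g = 0.
Proof.
move=> fg0; have [f0|f0] := eqVneq f 0; first by left.
have [g0|g0] := eqVneq g 0; first by right.
exfalso.
have supp_neq0 (h : pser) : h != 0 -> [set a | h a != 0] !=set0.
  move=> h0; apply: contrapT => H; move/eqP: h0; apply.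
  apply: pserP => a; apply/eqP; apply: contrapT => ha; apply: H.
  by exists a; apply/negP.
have [[k k0 fk] _] := pser_puiseux f; have [[l l0 gl] _] := pser_puiseux g.
have [a fa amin] := lexmin k0 fk (supp_neq0 _ f0).
have [b gb bmin] := lexmin l0 gl (supp_neq0 _ g0).
have := congr1 (fun h => coef h (a + b)) fg0; rewrite coefM coef0.
rewrite (fsbigTE [fset a]%fset) => [|c].
  rewrite big_seq_fset1 addrAC subrr add0r => /eqP.
  by rewrite mulf_eq0 (negbTE fa) (negbTE gb).
rewrite in_fset1 => /eqP ca.
have [->|fc] := eqVneq (f c) 0; first by rewrite mul0r.
have [->|gc] := eqVneq (g (a + b - c)) 0; first by rewrite mulr0.
exfalso; have [e|e] := pselect (a + b - c = b).
  have : a + b - c - b = 0 by rewrite e subrr.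
  by rewrite (addrAC _ (- c)) addrK => /subr0_eq/esym.
apply: (lexlt_add (amin _ fc ca) (bmin _ gc e)).
by rewrite [RHS]addrC subrK.
Qed.

End PuiseuxRing.

Section ConvergentSeries.
Variables (R : realType) (d : nat).
Local Notation C := R[i].
Local Notation Q := 'rV[rat]_d.
Local Notation pser := (pser R d).
Implicit Types (E F : set Q) (a b : Q) (c : C).

(* The submonoid of Q^d generated by E. *)
Inductive mon_gen E : Q -> Prop :=
| mon_gen0 : mon_gen E 0
| mon_gen_add a b of E a & mon_gen E b : mon_gen E (a + b).

Lemma mon_genD E a b : mon_gen E a -> mon_gen E b -> mon_gen E (a + b).
Proof.
move=> Ea Eb; elim: Ea => [|a1 a2 Ea1 _ ih]; first by rewrite add0r.
by rewrite -addrA; exact: mon_gen_add.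
Qed.

Lemma sub_mon_gen E a : E a -> mon_gen E a.
Proof. by move=> Ea; rewrite -[a]addr0; apply: mon_gen_add => //; left. Qed.

Definition supported E : {pred pser} :=
  fun f => `[< forall a, f a != 0 -> mon_gen E a >].

Lemma supported_subring E : subring_closed (supported E).
Proof.
split=> [|f g /asboolP fE /asboolP gE|f g /asboolP fE /asboolP gE]; apply/asboolP.
- move=> a; rewrite coef1; have [-> _|_] := eqVneq a 0; first exact: mon_gen0.
  by rewrite eqxx.
- move=> a; have [fa|/fE//] := eqVneq (f a) 0.
  by have [ga|/gE//] := eqVneq (g a) 0; rewrite coefB fa ga subr0 eqxx.
- move=> a /pmul_neq0[b [/fE fb /gE gb]].
  by rewrite -(subrK b a) addrC; exact: mon_genD.
Qed.

(* The convergent power series whose exponents lie in the monoid generated by E: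
   C{X^(1/n)} for E = frac_exps n, C{Gamma} for E a generating set of Gamma,
   C{P} when E = P is already a submonoid of Q_{>=0}^d. *)
Record cps E := CPS { ser :> pser; _ : ser \in supported E }.

Section Instances.
Variable E : set Q.
HB.instance Definition _ := [isSub for @ser E].
HB.instance Definition _ := [Choice of cps E by <:].
HB.instance Definition _ :=
  GRing.isSubringClosed.Build pser (supported E) (supported_subring E).
HB.instance Definition _ := [SubChoice_isSubComNzRing of cps E by <:].

Definition cps_unit : {pred cps E} := fun f => `[< exists g, g * f = 1 >].
Definition cps_inv (f : cps E) : cps E := xget f [set g | g * f = 1].

Lemma cps_mulV : {in cps_unit, left_inverse 1 cps_inv *%R}.
Proof. by move=> f /asboolP[g gf]; rewrite /cps_inv; case: xgetP => [h _ //|/(_ g)]. Qed.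
Lemma cps_unitP f g : g * f = 1 -> cps_unit f.
Proof. by move=> gf; apply/asboolP; exists g. Qed.
Lemma cps_invr_out : {in [predC cps_unit], cps_inv =1 id}.
Proof.
move=> f /negP nu; rewrite /cps_inv; case: xgetP => // h _ hf.
by case: nu; exact: cps_unitP hf.
Qed.
HB.instance Definition _ := GRing.ComNzRing_hasMulInverse.Build (cps E)
  cps_mulV cps_unitP cps_invr_out.

Lemma cps_idomain : GRing.integral_domain_axiom (cps E).
Proof.
move=> f g /(congr1 val); rewrite rmorphM rmorph0 => /pser_mul_eq0 fg0.
by apply/orP; case: fg0 => e; [left|right]; apply/eqP/val_inj; rewrite e.
Qed.
HB.instance Definition _ := GRing.ComUnitRing_isIntegral.Build (cps E) cps_idomain.
End Instances.

Lemma cpsP E (f g : cps E) : (forall a, f a = g a) -> f = g.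
Proof. by move=> fg; apply/val_inj/pserP. Qed.

Lemma cps_unitE E (f : cps E) : (f \is a GRing.unit) <-> exists g, g * f = 1.
Proof. by split=> /asboolP. Qed.

Lemma cps_supp E (f : cps E) a : f a != 0 -> mon_gen E a.
Proof. by case: f => f /= /asboolP; exact. Qed.

(* The monomial c X^a. It is set to 0 when X^a is not a series of the ring (a is
   not in Q_{>=0}^d, or not in the monoid generated by E). *)
Definition pmono c a : pser := insubd 0 (fun b => if b == a then c else 0).
Definition mono E c a : cps E := insubd 0 (pmono c a).

Lemma puiseux_mono k c a : (0 < k)%N -> frac_exps k a ->
  puiseux (fun b => if b == a then c else 0).
Proof.
move=> k0 ka; split.
  by exists k => // b; have [->|_] := eqVneq b a; rewrite ?eqxx.
exists 1; rewrite ?ltr01//; exists (Normc.normc c) => s us.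
rewrite (eq_bigr (fun b => if b == a then Normc.normc c else 0)); last first.
  by move=> b _; rewrite powR1 mulr1; case: ifP => //; rewrite Normc.normc0.
have [sa|sa] := boolP (a \in s).
  rewrite (bigD1_seq a)//= eqxx big1 ?addr0// => b ba.
  by rewrite (negbTE ba).
rewrite big_seq big1 ?normc_ge0// => b sb; case: eqP => // ba.
by rewrite -ba sb in sa.
Qed.

Lemma monoE E k c a b : (0 < k)%N -> frac_exps k a -> mon_gen E a ->
  mono E c a b = if b == a then c else 0.
Proof.
move=> k0 ka Ea; rewrite /mono insubdK.
  by rewrite insubdK//; apply/asboolP; exact: puiseux_mono ka.
apply/asboolP => e; rewrite insubdK; last first.
  by apply/asboolP; exact: puiseux_mono ka.
by have [->|_] := eqVneq e a => //; rewrite eqxx.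
Qed.

Lemma mono0E E c b : mono E c 0 b = if b == 0 then c else 0.
Proof. by rewrite (@monoE _ 1)//; [exact: frac_exps0|left]. Qed.

Lemma mono10 E : mono E 1 0 = 1.
Proof. by apply: cpsP => a; rewrite mono0E coef1; case: eqP. Qed.

(* The maximal ideal of the local ring [cps E]. *)
Definition max_id E : set (cps E) := [set f | f 0 = 0].

Section Inclusion.
Variables (E F : set Q) (EF : {subset supported E <= supported F}).
Definition cps_incl (f : cps E) : cps F := CPS (EF (valP f)).
Lemma cps_incl_is_zmod_morphism : zmod_morphism cps_incl.
Proof. by move=> f g; apply/val_inj. Qed.
Lemma cps_incl_is_monoid_morphism : monoid_morphism cps_incl.
Proof. by split=> [|f g]; apply/val_inj. Qed.
HB.instance Definition _ := GRing.isZmodMorphism.Build (cps E) (cps F)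
  cps_incl cps_incl_is_zmod_morphism.
HB.instance Definition _ := GRing.isMonoidMorphism.Build (cps E) (cps F)
  cps_incl cps_incl_is_monoid_morphism.
Lemma cps_incl_mono c : cps_incl (mono E c 0) = mono F c 0.
Proof.
by apply: cpsP => a; rewrite mono0E; exact: mono0E.
Qed.
Lemma cps_incl_max_id f : max_id f -> max_id (cps_incl f).
Proof. by []. Qed.
End Inclusion.

End ConvergentSeries.

Section LogDerivative.
Variables (R : realType) (d : nat).
Local Notation C := R[i].
Local Notation Q := 'rV[rat]_d.
Implicit Types (E : set Q) (a b : Q) (u : 'cV[rat]_d).

Definition lform u a : rat := (a *m u) 0 0.

Lemma lformD u a b : lform u (a + b) = lform u a + lform u b.
Proof. by rewrite /lform mulmxDl mxE. Qed.

Lemma lform_bound u a : (forall i, 0 <= a 0 i) ->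
  `|lform u a| <= (\sum_i `|u i 0|) * deg a.
Proof.
move=> a0; rewrite /lform mxE mulr_sumr; apply: le_trans (ler_norm_sum _ _ _) _.
apply: ler_sum => i _; rewrite normrM (ger0_norm (a0 i)) mulrC.
by apply: ler_wpM2r => //; rewrite (bigD1 i)//= lerDl; exact: sumr_ge0.
Qed.

Lemma normc_rat (q : rat) : Normc.normc (ratr q : C) = `|ratr q|.
Proof.
rewrite -(fmorph_rat (real_complex R)) /= expr0n addr0 sqrtr_sqr.
by [].
Qed.

Lemma puiseux_log u (f : Q -> C) : puiseux f ->
  puiseux (fun a => ratr (lform u a) * f a).
Proof.
move=> [[k k0 fk] [r r0 [K KP]]]; split.
  exists k => // a; have [->|fa _] := eqVneq (f a) 0; last exact: fk.
  by rewrite mulr0 eqxx.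
pose W : R := ratr (\sum_i `|u i 0|).
have W0 : 0 <= W by rewrite ler0q; exact: sumr_ge0.
exists (r * expR (- 1)); first by rewrite mulr_gt0 ?expR_gt0.
exists (W * K) => s us; apply: le_trans (ler_wpM2l W0 (KP s us)).
rewrite mulr_sumr; apply: ler_sum => a _; rewrite normc_mul normc_rat.
have [->|fa] := eqVneq (f a) 0; first by rewrite Normc.normc0 !(mulr0,mul0r).
have a0 i : 0 <= a 0 i by apply: frac_exps_ge0 (fk _ fa).
have dega : 0 <= deg a by exact: deg_ge0 (fk _ fa).
set t : R := ratr (deg a); have t0 : 0 <= t by rewrite ler0q.
rewrite powRM ?(ltW r0) ?expR_ge0// -expRM mulN1r.
have le1 : `|ratr (lform u a)| <= W * t :> R.
  by rewrite -ratr_norm /W /t -rmorphM ler_rat; exact: lform_bound.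
have le2 : t * expR (- t) <= 1.
  rewrite expRN ler_pdivrMr ?expR_gt0// mul1r.
  by apply: le_trans (expR_ge1Dx _); rewrite lerDr.
set X := Normc.normc (f a) * r `^ t.
have X0 : 0 <= X by rewrite mulr_ge0 ?normc_ge0 ?powR_ge0.
rewrite (_ : _ * _ = `|ratr (lform u a)| * (X * expR (- t))); last first.
  by rewrite /X !mulrA.
apply: (@le_trans _ _ (W * t * (X * expR (- t)))).
  by apply: ler_wpM2r => //; rewrite mulr_ge0 ?expR_ge0.
by rewrite mulrACA -[leRHS]mulr1; apply: ler_wpM2l => //; rewrite mulr_ge0.
Qed.

Lemma log_supported E u (f : cps R E) :
  PSer (asboolT (puiseux_log u (pser_puiseux f))) \in supported E.
Proof.
apply/asboolP => a /=; have [->|fa _] := eqVneq (f a) 0; first by rewrite mulr0 eqxx.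
exact: cps_supp fa.
Qed.

(* sum_a c_a X^a |-> sum_a u(a) c_a X^a, for the linear form u on Q^d. *)
Definition dlog E u (f : cps R E) : cps R E := CPS (log_supported u f).

Lemma dlogE E u (f : cps R E) a : dlog u f a = ratr (lform u a) * f a.
Proof. by []. Qed.

Lemma dlogD E u (f g : cps R E) : dlog u (f + g) = dlog u f + dlog u g.
Proof. by apply: cpsP => a; rewrite coefD !dlogE coefD mulrDr. Qed.

Lemma dlog_cst E u (c : C) : dlog u (mono E c 0) = 0.
Proof.
apply: cpsP => a; rewrite dlogE mono0E coef0; case: eqP => [->|_].
  by rewrite /lform mul0mx mxE rmorph0 mul0r.
by rewrite mulr0.
Qed.

Lemma dlogM E u (f g : cps R E) :
  dlog u (f * g) = f * dlog u g + g * dlog u f.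
Proof.
have [k [k0 fk gk]] := puiseux_common2 (pser_puiseux f) (pser_puiseux g).
have fk' a : dlog u f a != 0 -> frac_exps k a.
  by rewrite dlogE mulf_eq0 negb_or => /andP[_ /fk].
have gk' a : dlog u g a != 0 -> frac_exps k a.
  by rewrite dlogE mulf_eq0 negb_or => /andP[_ /gk].
rewrite (mulrC g); apply: cpsP => a; have [A AP] := finite_pair a k0.
rewrite coefD dlogE /= !(pmulE AP)//.
rewrite mulr_sumr -big_split/=; apply: eq_bigr => b _.
have -> : lform u a = lform u (a - b) + lform u b by rewrite -lformD subrK.
rewrite rmorphD/= mulrDl mulrCA; congr (_ + _).
by rewrite mulrA.
Qed.

End LogDerivative.

Section Modules.
Local Open Scope quotient_scope.
Variables (A : comNzRingType) (V : lmodType A).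
Implicit Types (S T : set V) (a : A) (x y v w : V).

Inductive span S : V -> Prop :=
| span0 : span S 0
| span_lin a x v of S x & span S v : span S (a *: x + v).

Lemma spanD S v w : span S v -> span S w -> span S (v + w).
Proof.
move=> Sv Sw; elim: Sv => [|a x u Sx _ ih]; first by rewrite add0r.
by rewrite -addrA; exact: span_lin.
Qed.

Lemma spanZ S a v : span S v -> span S (a *: v).
Proof.
elim=> [|b x u Sx _ ih]; first by rewrite scaler0; exact: span0.
by rewrite scalerDr scalerA; exact: span_lin.
Qed.

Lemma sub_span S v : S v -> span S v.
Proof.
by move=> Sv; rewrite -[v]scale1r -[_ *: _]addr0; apply: span_lin => //; left.
Qed.

Lemma span_subset S T v : (forall x, S x -> span T x) -> span S v -> span T v.
Proof.
move=> ST; elim=> [|a x u Sx _ ih]; first exact: span0.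
by apply: spanD => //; apply: spanZ; exact: ST.
Qed.

Definition spanp S : {pred V} := fun v => `[< span S v >].

Lemma spanp_zmod_closed S : zmod_closed (spanp S).
Proof.
split=> [|v w /asboolP Sv /asboolP Sw]; apply/asboolP; first exact: span0.
by apply: spanD => //; rewrite -scaleN1r; exact: spanZ.
Qed.
HB.instance Definition _ S :=
  GRing.isZmodClosed.Build V (spanp S) (spanp_zmod_closed S).

(* The quotient of V by the submodule generated by S. *)
Definition quotmod S : Type := Quotient.quot (spanp S).
HB.instance Definition _ S := GRing.Zmodule.on (quotmod S).

Definition qpi S v : quotmod S := \pi_(Quotient.quot (spanp S)) v.
Definition qrepr S (q : quotmod S) : V := repr (q : Quotient.quot (spanp S)).

Lemma qreprK S (q : quotmod S) : qpi S (qrepr q) = q.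
Proof. exact: reprK. Qed.

Lemma qpiP S v w : qpi S v = qpi S w <-> span S (v - w).
Proof.
split=> [/eqP|H]; rewrite /qpi.
  by rewrite -Quotient.idealrBE => /asboolP.
by apply/eqP; rewrite -Quotient.idealrBE; exact/asboolP.
Qed.

Lemma qpiD S v w : qpi S (v + w) = qpi S v + qpi S w.
Proof. exact: (@Quotient.pi_add V (spanp S)). Qed.

Definition qscale S a (q : quotmod S) : quotmod S := qpi S (a *: qrepr q).

Lemma qpiZ S a v : qpi S (a *: v) = qscale a (qpi S v).
Proof.
rewrite /qscale; apply/qpiP; rewrite -scalerBr; apply: spanZ.
by apply/qpiP; rewrite qreprK.
Qed.

Lemma qscaleA S a b (q : quotmod S) : qscale a (qscale b q) = qscale (a * b) q.
Proof. by rewrite -[q]qreprK -!qpiZ scalerA. Qed.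
Lemma qscale1 S : left_id 1 (@qscale S).
Proof. by move=> q; rewrite -[q]qreprK -!qpiZ scale1r. Qed.
Lemma qscaleDr S : right_distributive (@qscale S) +%R.
Proof.
by move=> a p q; rewrite -[p]qreprK -[q]qreprK -!(qpiD, qpiZ) scalerDr.
Qed.
Lemma qscaleDl S (q : quotmod S) : {morph (@qscale S)^~ q : a b / a + b}.
Proof. by move=> a b; rewrite -[q]qreprK -!(qpiD, qpiZ) scalerDl. Qed.

HB.instance Definition _ S := GRing.Zmodule_isLmodule.Build A (quotmod S)
  (@qscaleA S) (@qscale1 S) (@qscaleDr S) (@qscaleDl S).

Lemma qpi_lin S a v w : qpi S (a *: v + w) = a *: qpi S v + qpi S w.
Proof. by rewrite qpiD qpiZ. Qed.

Lemma qpi_scale S a v : qpi S (a *: v) = a *: qpi S v.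
Proof. exact: qpiZ. Qed.

Lemma qpi0 S : qpi S 0 = 0.
Proof. by rewrite -(scale0r (0 : V)) qpi_scale scale0r. Qed.

End Modules.

Definition ideal (A : comNzRingType) (S : set A) : set A := @span A A^o S.

Section Lifts.
Variables (A B : comNzRingType) (rho : {rmorphism A -> B}).

Definition semilin (V : lmodType A) (N : lmodType B) (f : V -> N) :=
  forall a x y, f (a *: x + y) = rho a *: f x + f y.

Lemma semilin0 (V : lmodType A) (N : lmodType B) (f : V -> N) :
  semilin f -> f 0 = 0.
Proof.
move=> fl; have := fl 1 0 0; rewrite rmorph1 !scale1r addr0 => e.
by apply: (@addrI _ (f 0)); rewrite -e addr0.
Qed.

Lemma semilinD (V : lmodType A) (N : lmodType B) (f : V -> N) x y :
  semilin f -> f (x + y) = f x + f y.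
Proof. by move=> fl; have := fl 1 x y; rewrite rmorph1 !scale1r. Qed.

Lemma semilinZ (V : lmodType A) (N : lmodType B) (f : V -> N) a x :
  semilin f -> f (a *: x) = rho a *: f x.
Proof. by move=> fl; have := fl a x 0; rewrite semilin0// !addr0. Qed.

Lemma semilinB (V : lmodType A) (N : lmodType B) (f : V -> N) x y :
  semilin f -> f (x - y) = f x - f y.
Proof.
by move=> fl; rewrite semilinD// -scaleN1r semilinZ// rmorphN1 scaleN1r.
Qed.

Lemma semilin_span (V : lmodType A) (N : lmodType B) (f : V -> N) S T v :
  semilin f -> (forall x, S x -> span T (f x)) -> span S v -> span T (f v).
Proof.
move=> fl ST; elim=> [|a x u Sx _ ih]; first by rewrite semilin0//; exact: span0.
by rewrite fl; apply: spanD => //; apply: spanZ; exact: ST.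
Qed.

(* The rho-semilinear extension of phi to the free A-module {malg A[T]} on T,
   and, in [qlift], the map it induces on a quotient of that module. The latter
   is computed on representatives; it is the induced map as soon as the extension
   of phi kills the relations (lemmas [qliftE] and [qlift_semilin]). *)
Definition flift (T : choiceType) (N : lmodType B) (phi : T -> N)
  (v : {malg A[T]}) : N := \sum_(t <- msupp v) rho (mcoeff t v) *: phi t.

Lemma fliftE (T : choiceType) (N : lmodType B) (phi : T -> N) (v : {malg A[T]})
    (D : {fset T}) : (msupp v `<=` D)%fset ->
  flift phi v = \sum_(t <- D) rho (mcoeff t v) *: phi t.
Proof.
move=> vD; rewrite /flift; apply: big_fset_incl => // t _ tv.
by rewrite mcoeff_outdom// rmorph0 scale0r.
Qed.

Lemma flift_semilin (T : choiceType) (N : lmodType B) (phi : T -> N) :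
  semilin (flift phi).
Proof.
move=> a v w; pose D := (msupp (a *: v + w) `|` (msupp v `|` msupp w))%fset.
rewrite !(@fliftE _ _ _ _ D) /D ?fsubsetUl//; last 2 first.
- by rewrite fsubsetU// fsubsetUr orbT.
- by rewrite fsubsetU// fsubsetUl orbT.
rewrite scaler_sumr -big_split/=; apply: eq_bigr => t _.
by rewrite mcoeffD mcoeffZ rmorphD rmorphM scalerDl scalerA.
Qed.

Lemma fliftU (T : choiceType) (N : lmodType B) (phi : T -> N) t :
  flift phi (mkmalgU t 1) = phi t.
Proof.
rewrite (@fliftE _ _ _ _ [fset t]%fset) ?msuppU_le//.
by rewrite big_seq_fset1 mcoeffUU rmorph1 scale1r.
Qed.

Definition qlift (T : choiceType) (N : lmodType B) (S : set {malg A[T]})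
  (phi : T -> N) (q : quotmod S) : N := flift phi (qrepr q).

Lemma qliftE (T : choiceType) (N : lmodType B) (S : set {malg A[T]})
    (phi : T -> N) : (forall x, S x -> flift phi x = 0) ->
  forall v, qlift phi (qpi S v) = flift phi v.
Proof.
move=> H v; apply/eqP; rewrite -subr_eq0 /qlift.
rewrite -(semilinB _ _ (flift_semilin phi)).
have /qpiP : qpi S (qrepr (qpi S v)) = qpi S v by rewrite qreprK.
elim=> [|a x u Sx _ /eqP ih]; first by rewrite (semilin0 (flift_semilin phi)).
by rewrite flift_semilin H// scaler0 add0r ih.
Qed.

Lemma qlift_semilin (T : choiceType) (N : lmodType B) (S : set {malg A[T]})
    (phi : T -> N) : (forall x, S x -> flift phi x = 0) ->
  semilin (@qlift T N S phi).
Proof.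
move=> H a p q; rewrite -[p]qreprK -[q]qreprK -qpi_lin !qliftE//.
exact: flift_semilin.
Qed.

End Lifts.

Section MaximalIdealPowers.
Variables (A : comNzRingType) (m : set A).

(* The generators of m^k V. *)
Definition mpow (V : lmodType A) k : set V := [set v | exists (a : 'I_k -> A) w,
  (forall i, m (a i)) /\ v = (\prod_i a i) *: w].

Definition separated (V : lmodType A) :=
  forall v : V, (forall k, span (@mpow V k) v) -> v = 0.

End MaximalIdealPowers.
Arguments mpow {A} m {V} k _.

(* Analytic Kaehler differentials of a local analytic algebra A with maximal
   ideal m, where iota : K -> A is the inclusion of the constants: the module of
   Kaehler differentials of A (generated by the symbols dx, x in A, modulo
   additivity, the Leibniz rule and d(iota c) = 0), divided by the intersection
   of its submodules m^k Omega. For A = C{x}/I this is the universally finite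
   differential module, generated by dx_1, ..., dx_n. *)
Section Kahler.
Variables (A : comNzRingType) (K : Type) (iota : K -> A) (m : set A).
Local Notation "<< x >>" := (mkmalgU x (1 : A)).

Definition kahler_rel : set {malg A[A]} := [set v |
  [\/ exists x y, v = << x + y >> - << x >> - << y >>,
      exists x y, v = << x * y >> - x *: << y >> - y *: << x >>
    | exists c, v = << iota c >> ]].

Definition kahler_closure : set {malg A[A]} :=
  [set v | forall k, span (kahler_rel `|` mpow m k) v].

Definition kahler := quotmod kahler_closure.
HB.instance Definition _ := GRing.Lmodule.on kahler.

Definition kd (x : A) : kahler := qpi kahler_closure << x >>.

Lemma kahler_closure_span v : span kahler_closure v -> kahler_closure v.
Proof. by move=> H k; apply: span_subset H => x; exact. Qed.

Lemma kahler_separated : separated m kahler.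
Proof.
move=> q H; rewrite -[q]qreprK; rewrite -[RHS](qpi0 kahler_closure).
apply/qpiP; rewrite subr0; apply: sub_span => k.
suff [w [kw wq]] : exists w, span (mpow m k) w /\ qpi kahler_closure w = q.
  have : kahler_closure (qrepr q - w).
    by apply: kahler_closure_span; apply/qpiP; rewrite qreprK wq.
  move=> /(_ k) H2; rewrite -(subrK w (qrepr q)); apply: spanD => //.
  by apply: span_subset kw => x xk; apply: sub_span; right.
elim: (H k) => [|a x u [b [y [bm ->]]] _ [w [kw wu]]].
  exists 0; split; first exact: span0.
  exact: qpi0.
exists (a *: ((\prod_i b i) *: qrepr y) + w); split.
  by apply: span_lin => //; exists b, (qrepr y).
by rewrite !qpi_lin wu qpi_scale qreprK.
Qed.

Lemma kdD x y : kd (x + y) = kd x + kd y.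
Proof.
rewrite /kd -qpiD; apply/qpiP; apply: sub_span => k; apply: sub_span; left.
by constructor 1; exists x, y; rewrite opprD addrA.
Qed.

Lemma kdM x y : kd (x * y) = x *: kd y + y *: kd x.
Proof.
rewrite /kd -!qpi_scale -qpiD; apply/qpiP; apply: sub_span => k; apply: sub_span; left.
by constructor 2; exists x, y; rewrite opprD addrA.
Qed.

Lemma kd_cst c : kd (iota c) = 0.
Proof.
rewrite -[RHS](qpi0 kahler_closure).
apply/qpiP; rewrite subr0; apply: sub_span => k; apply: sub_span; left.
by constructor 3; exists c.
Qed.

End Kahler.

Section KahlerLift.
Variables (A B : comNzRingType) (rho : {rmorphism A -> B}).
Variables (K : Type) (iA : K -> A) (mA : set A) (mB : set B).
Variables (N : lmodType B) (D : A -> N).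

Definition kahler_lift : kahler iA mA -> N := qlift rho D.

Hypotheses (rho_m : forall x, mA x -> mB (rho x)) (Nsep : separated mB N).
Hypotheses (DD : forall x y, D (x + y) = D x + D y)
  (DM : forall x y, D (x * y) = rho x *: D y + rho y *: D x)
  (DK : forall c, D (iA c) = 0).

Lemma kahler_lift_kills v : kahler_closure iA mA v -> flift rho D v = 0.
Proof.
move=> cv; apply: Nsep => k.
have fl := flift_semilin rho D.
apply: (semilin_span fl _ (cv k)) => x [[[y [z ->]]|[y [z ->]]|[c ->]]|].
- rewrite !(semilinB _ _ fl) !fliftU DD addrAC addrK subrr.
  exact: span0.
- rewrite !(semilinB _ _ fl) !(semilinZ _ _ fl) !fliftU DM.
  by rewrite addrAC addrK subrr; exact: span0.
- by rewrite fliftU DK; exact: span0.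
- move=> [b [w [bm ->]]]; rewrite (semilinZ _ _ fl) rmorph_prod.
  apply: sub_span; exists (fun i => rho (b i)), (flift rho D w); split=> // i.
  exact: rho_m.
Qed.

Lemma kahler_lift_semilin : semilin rho kahler_lift.
Proof. exact/qlift_semilin/kahler_lift_kills. Qed.

Lemma kahler_liftE x : kahler_lift (kd iA mA x) = D x.
Proof. by rewrite /kahler_lift qliftE ?fliftU//; exact: kahler_lift_kills. Qed.

End KahlerLift.

Section ExteriorPower.
Variables (A : comNzRingType) (n : nat) (V : lmodType A).
Implicit Types (t : {ffun 'I_n -> V}).
Local Notation "<< x >>" := (mkmalgU x (1 : A)).

Definition upd t i (x : V) : {ffun 'I_n -> V} :=
  [ffun j => if j == i then x else t j].

(* The n-th exterior power of V is the free module on the n-tuples of vectors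
   modulo multilinearity and alternation. *)
Definition ext_rel : set {malg A[{ffun 'I_n -> V}]} := [set v |
  (exists t i a x y,
     v = << upd t i (a *: x + y) >> - a *: << upd t i x >> - << upd t i y >>) \/
  (exists t i j, [/\ i != j, t i = t j & v = << t >>])].

Definition extpow := quotmod ext_rel.
HB.instance Definition _ := GRing.Lmodule.on extpow.

Definition wedge t : extpow := qpi ext_rel << t >>.

Lemma wedge_lin t i a x y :
  wedge (upd t i (a *: x + y)) = a *: wedge (upd t i x) + wedge (upd t i y).
Proof.
rewrite /wedge -qpi_lin; apply/qpiP; apply: sub_span; left.
by exists t, i, a, x, y; rewrite opprD addrA.
Qed.

Lemma wedge_alt t i j : i != j -> t i = t j -> wedge t = 0.
Proof.
move=> ij tij; rewrite -[RHS](qpi0 ext_rel).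
by apply/qpiP; rewrite subr0; apply: sub_span; right; exists t, i, j.
Qed.

End ExteriorPower.

Section ExteriorLift.
Variables (A B : comNzRingType) (rho : {rmorphism A -> B}) (n : nat).
Variables (V : lmodType A) (N : lmodType B) (phi : {ffun 'I_n -> V} -> N).

Definition ext_lift : extpow n V -> N := qlift rho phi.

Hypothesis phi_lin : forall t i a x y,
  phi (upd t i (a *: x + y)) = rho a *: phi (upd t i x) + phi (upd t i y).
Hypothesis phi_alt : forall (t : {ffun 'I_n -> V}) i j, i != j -> t i = t j -> phi t = 0.

Lemma ext_lift_kills v : @ext_rel A n V v -> flift rho phi v = 0.
Proof.
have fl := flift_semilin rho phi.
move=> [[t [i [a [x [y ->]]]]]|[t [i [j [ij tij ->]]]]].
  rewrite !(semilinB _ _ fl) (semilinZ _ _ fl) !fliftU phi_lin.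
  by rewrite addrAC addrK subrr.
by rewrite fliftU (phi_alt ij).
Qed.

Lemma ext_lift_semilin : semilin rho ext_lift.
Proof. exact/qlift_semilin/ext_lift_kills. Qed.

Lemma ext_liftE t : ext_lift (wedge t) = phi t.
Proof. by rewrite /ext_lift qliftE ?fliftU//; exact: ext_lift_kills. Qed.

End ExteriorLift.

Section ExteriorMap.
Variables (A B : comNzRingType) (rho : {rmorphism A -> B}) (n : nat).
Variables (V : lmodType A) (W : lmodType B) (phi : V -> W).

Definition ext_map : extpow n V -> extpow n W :=
  ext_lift rho (fun t => wedge [ffun i => phi (t i)]).

Hypothesis phi_lin : semilin rho phi.

Let upd_map t i x :
  [ffun j => phi (@upd A n V t i x j)] = upd [ffun j => phi (t j)] i (phi x).
Proof. by apply/ffunP => j; rewrite !ffunE; case: eqP. Qed.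

Let map_lin t i a x y :
  wedge [ffun j => phi (@upd A n V t i (a *: x + y) j)] =
  rho a *: wedge [ffun j => phi (upd t i x j)] + wedge [ffun j => phi (upd t i y j)].
Proof. by rewrite !upd_map phi_lin wedge_lin. Qed.

Let map_alt (t : {ffun 'I_n -> V}) i j : i != j -> t i = t j ->
  wedge [ffun j => phi (t j)] = 0.
Proof. by move=> ij tij; apply: (wedge_alt ij); rewrite !ffunE tij. Qed.

Lemma ext_map_semilin : semilin rho ext_map.
Proof. exact: ext_lift_semilin map_lin map_alt. Qed.

Lemma ext_mapE t : ext_map (wedge t) = wedge [ffun i => phi (t i)].
Proof. exact: ext_liftE map_lin map_alt _. Qed.

End ExteriorMap.

Section ExteriorDet.
Variables (A : comNzRingType) (n : nat).

(* The isomorphism from the n-th exterior power of A^n to A given by the canonical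
   basis of A^n. *)
Definition det_rows (t : {ffun 'I_n -> 'rV[A]_n}) : A^o :=
  \det (\matrix_(i < n, j < n) t i 0 j).

Definition ext_det : extpow n 'rV[A]_n -> A^o := ext_lift idfun det_rows.

Let det_lin t i (a : A) x y :
  det_rows (upd t i (a *: x + y)) =
  a *: det_rows (upd t i x) + det_rows (upd t i y).
Proof.
rewrite -[RHS]/(a * det_rows (upd t i x) + det_rows (upd t i y)).
rewrite -[det_rows (upd t i y)](mul1r (det_rows (upd t i y) : A)).
apply: (@determinant_multilinear A n _ _ _ i).
- by apply/rowP => j; rewrite !mxE !ffunE eqxx !mxE mul1r.
- by apply/matrixP => k j; rewrite !mxE !ffunE eq_sym (negbTE (neq_lift _ _)).
- by apply/matrixP => k j; rewrite !mxE !ffunE eq_sym (negbTE (neq_lift _ _)).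
Qed.

Let det_alt (t : {ffun 'I_n -> 'rV[A]_n}) i j : i != j -> t i = t j ->
  det_rows t = 0.
Proof.
by move=> ij tij; apply: (determinant_alternate ij) => k; rewrite !mxE tij.
Qed.

Lemma ext_det_semilin : semilin idfun ext_det.
Proof. exact: (ext_lift_semilin (rho := idfun) det_lin det_alt). Qed.

Lemma ext_detE t : ext_det (wedge t) = det_rows t.
Proof. exact: (ext_liftE (rho := idfun) det_lin det_alt). Qed.

End ExteriorDet.

Section Separated.
Variables (R : realType) (d : nat) (E : set 'rV[rat]_d) (k : nat).
Hypotheses (k0 : (0 < k)%N)
  (Ek : forall l a, (0 < l)%N -> frac_exps l a -> mon_gen E a -> frac_exps k a).
Local Notation cps := (cps R E).

Let order_ge (q : rat) (f : cps) := forall a, f a != 0 -> q <= deg a.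

Let cps_frac (f : cps) a : f a != 0 -> frac_exps k a.
Proof.
move=> fa; have [[l l0 fl] _] := pser_puiseux f.
exact: Ek l0 (fl _ fa) (cps_supp fa).
Qed.

Let order_ge0 f : order_ge 0 f.
Proof. by move=> a /cps_frac; exact: deg_ge0. Qed.

Let order_geD q f g : order_ge q f -> order_ge q g -> order_ge q (f + g).
Proof.
move=> fq gq a; have [fa|/fq//] := eqVneq (f a) 0.
by have [ga|/gq//] := eqVneq (g a) 0; rewrite coefD fa ga addr0 eqxx.
Qed.

Let order_geM p q f g : order_ge p f -> order_ge q g -> order_ge (p + q) (f * g).
Proof.
move=> fp gq a /pmul_neq0[b [/fp fb /gq gb]].
by rewrite -(subrK b a) degD addrC lerD.
Qed.

Let order_max f : max_id f -> order_ge k%:R^-1 f.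
Proof.
move=> f0 a fa; have ak := cps_frac fa.
have [i ai] : exists i, a 0 i != 0.
  apply: contrapT => H; move/eqP: fa; apply; rewrite (_ : a = 0)//.
  by apply/rowP => i; rewrite mxE; apply: contrapT => /eqP ai; apply: H; exists i.
have [m am] := ak i; rewrite /deg (bigD1 i)//=.
apply: (@le_trans _ _ (a 0 i)); last first.
  by rewrite lerDl; apply: sumr_ge0 => j _; exact: frac_exps_ge0 ak.
have m0 : (0 < m)%N by rewrite lt0n; apply: contra ai => /eqP m0; rewrite am m0 mul0r.
by rewrite am ler_peMl ?invr_ge0 ?ler0n// ler1n.
Qed.

Let order_prod n (f : 'I_n -> cps) : (forall i, max_id (f i)) ->
  order_ge (n%:R / k%:R) (\prod_i f i).
Proof.
elim: n f => [|n ih] f fm; first by rewrite mul0r; exact: order_ge0.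
have -> : n.+1%:R / k%:R = k%:R^-1 + n%:R / k%:R :> rat.
  by rewrite -addn1 addnC natrD mulrDl mul1r.
rewrite big_ord_recl.
by apply: order_geM; [exact: order_max|exact: ih].
Qed.

Lemma cps_separated n : separated (@max_id R d E) 'rV[cps]_n.
Proof.
move=> v Hv; apply/rowP => j; rewrite mxE; apply: cpsP => a; rewrite coef0.
apply: contrapT => /eqP va.
suff H l : l%:R / k%:R <= deg a.
  have kp : (0 : rat) < k%:R by rewrite ltr0n.
  have := H (`|numq (deg a * k%:R)|.+1)%N; rewrite ler_pdivrMr// => le1.
  have : deg a * k%:R <= (`|numq (deg a * k%:R)|%N)%:R.
    rewrite -[X in X <= _]divq_num_den ler_pdivrMr ?ltr0z ?denq_gt0//.
    apply: le_trans (ler_norm _) _; rewrite -intr_norm -abszE -pmulrn.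
    by rewrite ler_peMr ?ler0n// ler1z -gtz0_ge1 denq_gt0.
  by move=> le2; have := le_trans le1 le2; rewrite ler_nat ltnn.
move: va; suff : order_ge (l%:R / k%:R) (v 0 j) by exact.
elim: (Hv l) => [|b x u [c [w [cm ->]]] _ ih].
  by move=> e; rewrite mxE coef0 eqxx.
rewrite !mxE; apply: order_geD => //.
rewrite mulrCA -[l%:R / _]addr0; apply: order_geM; first exact: order_prod.
exact: order_ge0.
Qed.

End Separated.

Section Semigroup.
Variable d : nat.
Local Notation Q := 'rV[rat]_d.
Implicit Types (lam : seq Q) (a b : Q).

(* The index [M : N], as the number of cosets a + N with a in M. *)
Definition index (M N : set Q) : nat :=
  #|` fset_set [set [set a + b | b in N] | a in M] |.

(* Sequences are indexed from 0: lambda_j is lam`_(j-1), and [nidx], [lbar] are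
   shifted in the same way. [Mlat lam j] is M_j. *)
Fixpoint Mlat lam j : set Q :=
  if j is i.+1
  then [set a + lam`_i *~ z | a in Mlat lam i & z in [set: int]]
  else [set a | exists z : 'rV[int]_d, a = map_mx intr z].

Definition nidx lam j : nat := index (Mlat lam j.+1) (Mlat lam j).

Fixpoint lbar lam j : Q :=
  if j is i.+1 then lbar lam i *+ nidx lam i + lam`_i.+1 - lam`_i else lam`_0.

(* The generators e_1, ..., e_d, lbar_1, ..., lbar_g of Gamma. *)
Definition gam g lam (i : 'I_(d + g)) : Q :=
  match fintype.split i with
  | inl i => delta_mx 0 i
  | inr j => lbar lam j
  end.

Definition sgens g lam : set Q := range (@gam g lam).

Definition cone (M : set Q) : set Q := [set a | M a /\ forall i, 0 <= a 0 i].

(* The vector gamma_0. *)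
Definition frob g lam : Q :=
  \sum_(j < g) lbar lam j *+ (nidx lam j).-1 - \sum_(i < d) delta_mx 0 i.

(* The relations n_j lbar_j = sum_i ell_i^(j) gamma_i, the sum being over the first
   d + j - 1 generators. Entries of ell with a larger index are not used. *)
Definition normal_form g lam (ell : 'I_g -> 'I_(d + g) -> nat) :=
  forall j : 'I_g,
    lbar lam j *+ nidx lam j =
      \sum_(i < d + g | (i < d + j)%N) gam lam i *+ ell j i /\
    forall k : 'I_g, (k < j)%N -> (ell j (rshift d k) < nidx lam k)%N.

Definition zbasis (b : 'M[rat]_d) (M : set Q) :=
  b \in unitmx /\ M = [set a | exists z : 'rV[int]_d, a = map_mx intr z *m b].

Lemma Mlat_group lam j : Mlat lam j 0 /\
  (forall a b, Mlat lam j a -> Mlat lam j b -> Mlat lam j (a - b)).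
Proof.
elim: j => [|j [ih0 ihB]]; split=> [|a b].
- by exists 0; rewrite map_mx0.
- by move=> [x ->] [y ->]; exists (x - y); rewrite map_mxB.
- by exists 0 => //; exists 0 => //; rewrite mulr0z addr0.
- move=> [x xM [y _ <-]] [z zM [t _ <-]]; exists (x - z); first exact: ihB.
  by exists (y - t) => //; rewrite mulrzBr opprD addrACA.
Qed.

Lemma MlatN lam j a : Mlat lam j a -> Mlat lam j (- a).
Proof. by have [M0 MB] := Mlat_group lam j; move=> /(MB 0 _ M0); rewrite sub0r. Qed.

Lemma MlatD lam j a b : Mlat lam j a -> Mlat lam j b -> Mlat lam j (a + b).
Proof.
move=> Ma /MlatN Mb; rewrite -[b]opprK.
by have [_ MB] := Mlat_group lam j; exact: MB.
Qed.

Lemma MlatMn lam j a n : Mlat lam j a -> Mlat lam j (a *+ n).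
Proof.
move=> Ma; elim: n => [|n ih]; first by rewrite mulr0n; case: (Mlat_group lam j).
by rewrite mulrS; exact: MlatD.
Qed.

Lemma Mlat_lam lam j : Mlat lam j.+1 lam`_j.
Proof.
have [M0 _] := Mlat_group lam j.
by exists 0 => //; exists 1 => //; rewrite add0r mulr1z.
Qed.

Lemma MlatS lam j a : Mlat lam j a -> Mlat lam j.+1 a.
Proof. by move=> Ma; exists a => //; exists 0 => //; rewrite mulr0z addr0. Qed.

Lemma Mlat_le lam i j a : (i <= j)%N -> Mlat lam i a -> Mlat lam j a.
Proof.
move=> ij Ma; rewrite -(subnK ij); elim: (j - i)%N => [|n ih]; first by [].
by rewrite addSn; exact: MlatS.
Qed.

Lemma Mlat_lbar lam j : Mlat lam j.+1 (lbar lam j).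
Proof.
elim: j => [|j ih]; first exact: Mlat_lam.
rewrite [lbar _ _]/=; apply: MlatD; last by apply/MlatN/MlatS; exact: Mlat_lam.
by apply: MlatD; [apply: MlatS; exact: MlatMn|exact: Mlat_lam].
Qed.

Lemma Mlat_gam g lam (i : 'I_(d + g)) : Mlat lam g (gam lam i).
Proof.
rewrite /gam; case: splitP => [k _|k _]; last exact: Mlat_le (Mlat_lbar lam k).
apply: (@Mlat_le _ 0) => //; exists (delta_mx 0 k).
by rewrite map_delta_mx.
Qed.

Lemma Mlat_sgens g lam a : mon_gen (@sgens g lam) a -> Mlat lam g a.
Proof.
elim=> [|x y [i _ <-] _ ih]; first by case: (Mlat_group lam g).
by apply: MlatD => //; exact: Mlat_gam.
Qed.

Lemma Mlat_cone lam j a : mon_gen (cone (Mlat lam j)) a -> cone (Mlat lam j) a.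
Proof.
elim=> [|x y [Mx x0] _ [My y0]].
  by split=> [|i]; [case: (Mlat_group lam j)|rewrite mxE].
by split=> [|i]; [exact: MlatD|rewrite mxE addr_ge0].
Qed.

Lemma Mlat_denom lam j : exists2 k, (0 < k)%N &
  forall a, Mlat lam j a -> forall i, exists z : int, a 0 i = z%:~R / k%:R.
Proof.
elim: j => [|j [k k0 ih]].
  exists 1%N => // a [z ->] i; exists (z 0 i); by rewrite mxE divr1.
pose l := (\prod_i `|denq (lam`_j 0%R i)|)%N.
have l0 : (0 < l)%N by rewrite prodn_gt0// => i; rewrite absz_gt0 denq_neq0.
have /choice[y yE] : forall i, exists z : int, lam`_j 0 i = z%:~R / l%:R.
  move=> i.
  pose e := (\prod_(k < d | k != i) `|denq (lam`_j 0%R k)|)%N.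
  exists (numq (lam`_j 0 i) * e%:Z).
  have e0 : (e%:R : rat) != 0.
    by rewrite pnatr_eq0 -lt0n prodn_cond_gt0// => t _; rewrite absz_gt0 denq_neq0.
  rewrite /l (bigD1 i)//= -/e natrM intrM -pmulrn -mulf_div divff// mulr1.
  by rewrite pmulrn abszE gtr0_norm ?denq_gt0// divq_num_den.
exists (k * l)%N; first by rewrite muln_gt0 k0.
move=> _ [a Ma [z _ <-]] i; have [x ax] := ih a Ma i.
exists (x * l%:Z + y i * z * k%:Z).
have kn : (k%:R : rat) != 0 by rewrite pnatr_eq0 -lt0n.
have ln : (l%:R : rat) != 0 by rewrite pnatr_eq0 -lt0n.
rewrite mxE -scaler_int mxE ax yE mulrA addf_div// natrM; congr (_ / _).
by rewrite intrD !intrM !pmulrn (mulrC z%:~R).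
Qed.

Lemma cone_frac lam j : exists2 k, (0 < k)%N &
  forall a, mon_gen (cone (Mlat lam j)) a -> frac_exps k a.
Proof.
have [k k0 kP] := Mlat_denom lam j; exists k => // a /Mlat_cone[Ma a0] i.
have [z az] := kP a Ma i; exists `|z|%N.
have kp : (0 : rat) < k%:R by rewrite ltr0n.
have z0 : 0 <= z by have := a0 i; rewrite az pmulr_lge0 ?invr_gt0// ler0z.
by rewrite az; congr (_ / _); rewrite pmulrn abszE ger0_norm.
Qed.

Lemma sgens_sub_cone (R : realType) g lam :
  {subset @supported R d (@sgens g lam) <= supported (cone (Mlat lam g))}.
Proof.
move=> f /asboolP fE; apply/asboolP => a fa; apply: sub_mon_gen.
split; first exact/Mlat_sgens/fE.
have [[k k0 fk] _] := pser_puiseux f.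
by move=> i; exact: frac_exps_ge0 (fk _ fa).
Qed.

End Semigroup.


Section Germs.
Variables (R : realType) (d g : nat) (lam : seq 'rV[rat]_d).
Local Notation C := R[i].
Local Notation Q := 'rV[rat]_d.

(* The local rings C{Gamma} of the germ S_0 = (Z^Gamma, 0) and
   C{sigma^vee inter M} of its normalization Z. *)
Definition OS0 := cps R (@sgens d g lam).
Definition OZ := cps R (cone (Mlat lam g)).
HB.instance Definition _ := GRing.IntegralDomain.on OS0.
HB.instance Definition _ := GRing.IntegralDomain.on OZ.

Definition S0Z : {rmorphism OS0 -> OZ} := cps_incl (@sgens_sub_cone d R g lam).

Definition Omega (E : set Q) : lmodType (cps R E) :=
  kahler (fun c : C => mono E c 0) (@max_id R d E).
Definition OmegaS0 : lmodType OS0 := Omega (@sgens d g lam).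
Definition OmegaZ : lmodType OZ := Omega (cone (Mlat lam g)).

Definition dS0 : OS0 -> OmegaS0 := kd _ _.
Definition dZ : OZ -> OmegaZ := kd _ _.

Definition OmegaS0Z : OmegaS0 -> OmegaZ := kahler_lift S0Z (fun x => dZ (S0Z x)).

(* O_Z (x) M is identified with O_Z^d by the basis of M given by the rows of b, so
   that X^a (x) a has coordinates (a *m invmx b) 0 i X^a. *)
Definition dlogs (b : 'M[rat]_d) (f : OZ) : 'rV[OZ]_d :=
  \row_i dlog (col i (invmx b)) f.

Definition eta (b : 'M[rat]_d) : OmegaZ -> 'rV[OZ]_d :=
  kahler_lift idfun (dlogs b).

Lemma OmegaS0Z_semilin : semilin S0Z OmegaS0Z.
Proof.
apply: (@kahler_lift_semilin _ _ _ _ _ _ (@max_id R d _)) => //.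
- exact: kahler_separated.
- by move=> x y; rewrite rmorphD; exact: kdD.
- by move=> x y; rewrite rmorphM; exact: kdM.
- move=> c; rewrite /S0Z /= cps_incl_mono; exact: kd_cst.
Qed.

Lemma OmegaS0Z_d x : OmegaS0Z (dS0 x) = dZ (S0Z x).
Proof.
apply: (@kahler_liftE _ _ _ _ _ _ (@max_id R d _)) => //.
- exact: kahler_separated.
- by move=> y z; rewrite rmorphD; exact: kdD.
- by move=> y z; rewrite rmorphM; exact: kdM.
- move=> c; rewrite /S0Z /= cps_incl_mono; exact: kd_cst.
Qed.

Lemma OZ_separated n : separated (@max_id R d _) 'rV[OZ]_n.
Proof.
have [k k0 kP] := cone_frac lam g.
by apply: (cps_separated k0) => l a _ _; exact: kP.
Qed.

Lemma dlogsD b x y : dlogs b (x + y) = dlogs b x + dlogs b y.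
Proof. by apply/rowP => i; rewrite !mxE dlogD. Qed.

Lemma dlogsM b x y : dlogs b (x * y) = x *: dlogs b y + y *: dlogs b x.
Proof. by apply/rowP => i; rewrite !mxE dlogM. Qed.

Lemma dlogs_cst b (c : C) : dlogs b (mono _ c 0) = 0.
Proof. by apply/rowP => i; rewrite !mxE dlog_cst. Qed.

Lemma eta_semilin b : semilin idfun (eta b).
Proof.
apply: (@kahler_lift_semilin _ _ _ _ _ _ (@max_id R d _)) => //.
- exact: OZ_separated.
- exact: dlogsD.
- exact: dlogsM.
- exact: dlogs_cst.
Qed.

Lemma eta_d b f : eta b (dZ f) = dlogs b f.
Proof.
apply: (@kahler_liftE _ _ _ _ _ _ (@max_id R d _)) => //.
- exact: OZ_separated.
- exact: dlogsD.
- exact: dlogsM.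
- exact: dlogs_cst.
Qed.

Definition logmap (b : 'M[rat]_d) : extpow d OmegaS0 -> OZ :=
  fun w => ext_det (ext_map idfun (eta b) (ext_map S0Z OmegaS0Z w)).

Lemma logmap_wedge b (f : 'I_d -> OS0) :
  logmap b (wedge [ffun i => dS0 (f i)]) =
  \det (\matrix_(i, j) dlog (col j (invmx b)) (S0Z (f i))).
Proof.
rewrite /logmap (ext_mapE OmegaS0Z_semilin) (ext_mapE (@eta_semilin b)).
rewrite ext_detE; congr (\det _); apply/matrixP => i j.
by rewrite !mxE !ffunE OmegaS0Z_d eta_d mxE.
Qed.

Lemma logmap_semilin b a v w :
  logmap b (a *: v + w) = S0Z a * logmap b v + logmap b w.
Proof.
rewrite /logmap (ext_map_semilin OmegaS0Z_semilin).
by rewrite (ext_map_semilin (@eta_semilin b)) ext_det_semilin.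
Qed.

(* J_log(S_0) O_Z *)
Definition Jlog (b : 'M[rat]_d) : set OZ := ideal (range (logmap b)).

(* h_j *)
Definition hpoly (ell : 'I_g -> 'I_(d + g) -> nat) (j : 'I_g) : mpoly (d + g) C :=
  \prod_(i < d + g | (i < d + j)%N) 'X_i ^+ ell j i
  - 'X_(rshift d j) ^+ nidx lam j.

(* U_i |-> X^gamma_i *)
Definition evU (p : mpoly (d + g) C) : OZ :=
  mpoly.mmap (fun c => mono _ c 0) (fun i => mono _ 1 (gam lam i)) p.

Definition jacmx (ell : 'I_g -> 'I_(d + g) -> nat) :
    'M[mpoly (d + g) C]_(g, d + g) :=
  \matrix_(j < g, i < d + g) mderiv i (hpoly ell j).

(* Jac(S_0) O_Z *)
Definition Jac (ell : 'I_g -> 'I_(d + g) -> nat) : set OZ :=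
  ideal [set x | exists2 s : 'I_g -> 'I_(d + g),
    {homo s : i j / (i < j)%N} & x = evU (\det (colsub s (jacmx ell)))].

(* The wedge product is taken in the d-th exterior power of Q^d = M (x) Q, into
   which that of M embeds. *)
Definition Ideal_g : set OZ :=
  ideal [set x | exists s : 'I_d -> 'I_(d + g),
    [/\ {homo s : i j / (i < j)%N},
        wedge [ffun k => gam lam (s k)] != 0 :> extpow d 'rV[rat]_d &
        x = mono _ 1 (\sum_k gam lam (s k))]].

(* X^a in the fraction field of O_Z, for a in M: it is X^(a + u) / X^u for an
   integral vector u with u >= 0 and a + u >= 0. *)
Definition fmono (a : Q) : {fraction OZ} :=
  let u : Q := const_mx (\sum_i `|numq (a 0%R i)|)%N%:R in
  tofrac (mono _ 1 (a + u) : OZ) / tofrac (mono _ 1 u : OZ).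

End Germs.

Section QuasiOrdinary.
Variables (R : realType) (d : nat).
Local Notation C := R[i].
Local Notation Q := 'rV[rat]_d.

(* C{X_1^(1/n), ..., X_d^(1/n)}; C{X} is the case n = 1. *)
Definition CX (n : nat) := cps R (@frac_exps d n).
HB.instance Definition _ n := GRing.IntegralDomain.on (CX n).

Implicit Types f : {poly CX 1}.

Definition weierstrass f :=
  f \is monic /\ forall i, (i < (size f).-1)%N -> max_id f`_i.

Definition discriminant f : CX 1 :=
  (-1) ^+ 'C((size f).-1, 2) * resultant f f^`().

Definition quasi_ordinary f :=
  weierstrass f /\ exists (delta : 'rV[nat]_d) (eps : CX 1),
    eps \is a GRing.unit /\
    discriminant f = mono _ 1 (map_mx (fun m => m%:R) delta) * eps.

Definition irreducible_elt f :=
  [/\ f != 0, f \isn't a GRing.unit &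
   forall p q, f = p * q -> p \is a GRing.unit \/ q \is a GRing.unit].

Definition is_root f n (z : CX n) :=
  root (map_poly (fun c : CX 1 => ser c) f) (ser z).

Definition char_exps f : set Q :=
  let n := (size f).-1 in
  [set a | exists z1 z2 : CX n, [/\ is_root f z1, is_root f z2, z1 <> z2 &
     exists2 u : CX n, u \is a GRing.unit & z1 - z2 = mono _ 1 a * u]].

Definition prec (a b : Q) := (forall i, a 0 i <= b 0 i) /\ a <> b.

Definition char_exps_labelling f g (lam : g.-tuple Q) :=
  [set` lam] = char_exps f /\
  forall i j, (i < j < g)%N -> prec lam`_i lam`_j.

End QuasiOrdinary.

Arguments Jac R {d} g lam ell.
Arguments Jlog R {d} g lam b.
Arguments Ideal_g R {d} g lam.
Arguments fmono R {d} g lam a.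
Arguments frob {d} g lam.

(* Main.v *)
(** On the monomial variety parametrised by U_i |-> X^gamma_i, the logarithmic
    derivatives U_i dh_j/dU_i of the binomials become integer multiples of
    X^(n_j lbar_j); the multiples form a matrix L with L G = 0, where the rows of G
    are the gamma_i. Hence the minor of the Jacobian matrix on a set s of columns is
    a constant multiple of X^(gamma_0 + sum of gamma_i over i not in s), and the
    constant vanishes exactly when the complementary minor of G does.
    On the other side, the coordinates of a logarithmic differential of a series with
    exponents in Gamma are combinations of the X^gamma_i with gamma_i as coefficient
    vector, so that expanding a d x d determinant of such rows gives an element of
    I_g; the generators of I_g come from the differentials of the X^gamma_i. *)

Require Import Defs.
From HB Require Import structures.
From mathcomp Require Import all_boot all_order all_algebra fraction complex.
From mathcomp Require Import finmap monalg mpoly.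
From mathcomp Require Import boolp classical_sets cardinality fsbigop reals exp.

Set Implicit Arguments.
Unset Strict Implicit.
Unset Printing Implicit Defensive.

Import Order.TTheory GRing.Theory Num.Theory.

Local Open Scope classical_set_scope.
Local Open Scope ring_scope.

(** * Arithmetic of monomials in rings of convergent series *)

Section Monomials.
Variables (R : realType) (d : nat) (E : set 'rV[rat]_d) (k : nat).
Hypotheses (k0 : (0 < k)%N) (Ek : forall a, mon_gen E a -> frac_exps k a).
Local Notation C := R[i].
Local Notation Q := 'rV[rat]_d.
Implicit Types (a b : Q) (c : C) (f h : cps R E).

Lemma mono_coef c a b : mon_gen E a -> mono E c a b = if b == a then c else 0.
Proof. by move=> Ea; apply: monoE (Ek Ea) Ea. Qed.

Lemma mono_mul_coef c a f b : mon_gen E a -> (mono E c a * f) b = c * f (b - a).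
Proof.
move=> Ea; rewrite -[LHS]/(pmul (mono E c a) f b) /pmul.
rewrite (fsbigTE [fset a]%fset) => [|e].
  by rewrite big_seq_fset1 mono_coef// eqxx.
by rewrite in_fset1 mono_coef// => /negbTE ->; rewrite mul0r.
Qed.

Lemma mono_mul c c' a b : mon_gen E a -> mon_gen E b ->
  mono E c a * mono E c' b = mono E (c * c') (a + b).
Proof.
move=> Ea Eb; apply: cpsP => e; rewrite mono_mul_coef// !mono_coef//; last exact: mon_genD.
by rewrite subr_eq addrC; case: eqP => // _; rewrite mulr0.
Qed.

Lemma mono_neq0 a : mon_gen E a -> mono E 1 a != 0 :> cps R E.
Proof.
move=> Ea; apply/eqP => /(congr1 (fun f : cps R E => f a)).
by rewrite mono_coef// eqxx Defs.coef0 => /eqP; rewrite oner_eq0.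
Qed.

Lemma mono_prod (I : Type) (r : seq I) (F : I -> Q) : (forall i, mon_gen E (F i)) ->
  \prod_(i <- r) mono E (1 : C) (F i) = mono E 1 (\sum_(i <- r) F i) /\
  mon_gen E (\sum_(i <- r) F i).
Proof.
move=> EF; elim: r => [|i r [ih1 ih2]].
  by rewrite !big_nil mono10; split=> //; left.
by rewrite !big_cons ih1 mono_mul// mulr1; split=> //; exact: mon_genD.
Qed.

Lemma mono_exp a n : mon_gen E a ->
  mono E (1 : C) a ^+ n = mono E 1 (a *+ n) /\ mon_gen E (a *+ n).
Proof.
move=> Ea; elim: n => [|n [ih1 ih2]].
  by rewrite expr0 mulr0n mono10; split=> //; left.
by rewrite exprS ih1 mono_mul// mulr1 mulrS; split=> //; exact: mon_genD.
Qed.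

(** The quotient is [f] with its exponents shifted by [a]. It converges at the same radius r, with
    the bound divided by r^(deg a). *)
Lemma mono_divides a f : mon_gen E a ->
  (forall b, f b != 0 -> mon_gen E (b - a)) -> exists h, f = mono E 1 a * h.
Proof.
move=> Ea fa.
have hp : puiseux (fun b => f (b + a)).
  split; first by exists k => // b /fa; rewrite addrK => /Ek.
  have [_ [r r0 [K KP]]] := pser_puiseux f.
  have w0 : 0 < r `^ ratr (deg a) by exact: powR_gt0.
  exists r => //; exists (K / r `^ ratr (deg a)) => s us.
  rewrite ler_pdivlMr// mulr_suml.
  apply: le_trans (KP (map (fun b => b + a) s) _); last first.
    by rewrite map_inj_uniq//; exact: addIr.
  rewrite big_map; apply: ler_sum => b _.
  by rewrite degD rmorphD/= powRD ?mulrA// (gt_eqF r0) implybT.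
have hE : PSer (asboolT hp) \in supported E.
  by apply/asboolP => b /= /fa; rewrite addrK.
exists (CPS hE); apply: cpsP => b.
by rewrite mono_mul_coef// mul1r /= subrK.
Qed.

(** Comparing coefficients at [a + b] shows that [b] occurs in [f]. An exponent is thus shown to lie
    in the monoid because the quotient is already known to be a series. *)
Lemma mono_quotient a b c f : mon_gen E a -> mon_gen E (a + b) -> c != 0 ->
  mono E 1 a * f = mono E c (a + b) -> mon_gen E b.
Proof.
move=> Ea Eab c0 /(congr1 (fun h : cps R E => h (a + b))).
rewrite mono_mul_coef// mono_coef// eqxx mul1r addrAC subrr add0r => fb.
by apply: (@cps_supp _ _ _ f); rewrite fb.
Qed.

End Monomials.

(** * Constants and restriction of a series to a set of exponents *)

Section Constants.
Variables (R : realType) (d : nat) (E : set 'rV[rat]_d).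
Local Notation C := R[i].
Local Notation Q := 'rV[rat]_d.
Implicit Types (f h : cps R E) (P : set Q).

Definition cps_const (c : C) : cps R E := mono E c 0.

Lemma cps_const_coef c f a : (cps_const c * f) a = c * f a.
Proof.
rewrite -[LHS]/(pmul (mono E c 0) f a) /pmul.
rewrite (fsbigTE [fset 0]%fset) => [|e].
  by rewrite big_seq_fset1 mono0E eqxx subr0.
by rewrite in_fset1 mono0E => /negbTE ->; rewrite mul0r.
Qed.

Lemma cps_const_is_zmod_morphism : zmod_morphism cps_const.
Proof.
move=> x y; apply: cpsP => a; rewrite Defs.coefB !mono0E.
by case: eqP; rewrite ?subr0.
Qed.

Lemma cps_const_is_monoid_morphism : monoid_morphism cps_const.
Proof.
split=> [|x y]; first exact: mono10.
apply: cpsP => a; rewrite cps_const_coef /cps_const !mono0E.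
by case: eqP; rewrite ?mulr0.
Qed.

HB.instance Definition _ :=
  GRing.isZmodMorphism.Build C (cps R E) cps_const cps_const_is_zmod_morphism.
HB.instance Definition _ :=
  GRing.isMonoidMorphism.Build C (cps R E) cps_const cps_const_is_monoid_morphism.

Definition ratcst (q : rat) : cps R E := cps_const (ratr q).
HB.instance Definition _ := GRing.RMorphism.copy ratcst (cps_const \o @ratr C).

Lemma restr_subproof f P : puiseux (fun a => if `[< P a >] then f a else 0).
Proof.
have [[k k0 fk] [r r0 [K KP]]] := pser_puiseux f; split.
  by exists k => // a; case: ifP => [_ /fk//|]; rewrite eqxx.
exists r => //; exists K => s us; apply: le_trans (KP s us); apply: ler_sum => a _.
apply: ler_wpM2r; first exact: powR_ge0.
by case: ifP => // _; rewrite Normc.normc0 normc_ge0.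
Qed.

Lemma restr_supported f P : PSer (asboolT (restr_subproof f P)) \in supported E.
Proof.
by apply/asboolP => a /=; case: ifP => [_ /cps_supp//|]; rewrite eqxx.
Qed.

Definition restr f P : cps R E := CPS (restr_supported f P).

Lemma restrE f P a : restr f P a = if `[< P a >] then f a else 0.
Proof. by []. Qed.

Lemma cps_coef_sum (I : Type) (r : seq I) (D : pred I) (F : I -> cps R E) a :
  (\sum_(i <- r | D i) F i) a = \sum_(i <- r | D i) F i a.
Proof.
elim/big_rec2: _ => [|i x y _ <-]; first by rewrite Defs.coef0.
by rewrite Defs.coefD.
Qed.

Lemma restr_partition (T : finType) (p : Q -> T) f :
  f = \sum_t restr f [set a | p a = t].
Proof.
apply: cpsP => a; rewrite cps_coef_sum (bigD1 (p a))//= big1 => [|t tp].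
  by rewrite addr0 /= asboolT.
rewrite /=; case: ifP => // /asboolP pt.
by rewrite -pt eqxx in tp.
Qed.

Lemma dlog_sum u (I : Type) (r : seq I) (D : pred I) (F : I -> cps R E) :
  dlog u (\sum_(i <- r | D i) F i) = \sum_(i <- r | D i) dlog u (F i).
Proof.
elim/big_rec2: _ => [|i x y _ <-]; last by rewrite dlogD.
by apply: cpsP => a; rewrite dlogE Defs.coef0 mulr0.
Qed.

End Constants.

(** * Increasing index families and their complements *)

Section Complements.
Variable n : nat.

Lemma increasing_enumeration (A : {set 'I_n}) p : #|A| = p ->
  exists2 s : 'I_p -> 'I_n, {homo s : i j / (i < j)%N} & s @: 'I_p = A.
Proof.
move=> <-; exists (@enum_val _ (mem A)) => [i j ij|].
  have [x _] : exists x, x \in A by exists (enum_val i); exact: enum_valP.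
  rewrite !(enum_val_nth x) -!(nth_map x 0%N) -?cardE//.
  have iA := ltn_ord i; have jA := ltn_ord j.
  apply: (sorted_ltn_nth ltn_trans) => //; rewrite ?inE ?size_map -?cardE//.
  apply: (subseq_sorted ltn_trans (map_subseq _ (filter_subseq _ _))).
  by rewrite -enumT val_enum_ord iota_ltn_sorted.
apply/setP => x; apply/imsetP/idP => [[i _ ->]|xA]; first exact: enum_valP.
by exists (enum_rank_in xA x); rewrite ?enum_rankK_in.
Qed.

(** Distinct ordinals are comparable, so equal values would contradict strict monotonicity. *)
Lemma homo_ltn_inj p (s : 'I_p -> 'I_n) : {homo s : i j / (i < j)%N} -> injective s.
Proof.
move=> sh i j sij; have [/sh|/sh|/val_inj//] := ltngtP i j; by rewrite sij ltnn.
Qed.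

Lemma increasing_rearrangement p (f : 'I_p -> 'I_n) : injective f ->
  exists (s : 'I_p -> 'I_n) (t : perm.perm_of 'I_p),
    {homo s : i j / (i < j)%N} /\ forall i, f i = s (perm.fun_of_perm t i).
Proof.
move=> fi; have [|s sh sE] := @increasing_enumeration (f @: 'I_p) p.
  by rewrite card_imset ?card_ord.
have /choice[t tE] : forall i, exists j, f i = s j.
  move=> i; have : f i \in s @: 'I_p by rewrite sE imset_f.
  by move=> /imsetP[j _ ->]; exists j.
have ti : injective t by move=> i j tij; apply: fi; rewrite !tE tij.
by exists s, (perm.perm ti); split=> // i; rewrite perm.permE.
Qed.

(** Only injectivity is asked for, so the linear algebra does not depend on an ordering of the
    indices. *)
Definition complementary p q (s : 'I_p -> 'I_n) (c : 'I_q -> 'I_n) :=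
  [/\ injective s, injective c & s @: 'I_p = ~: (c @: 'I_q)].

Lemma complement_exists p q (s : 'I_p -> 'I_n) : (p + q)%N = n ->
  {homo s : i j / (i < j)%N} ->
  exists2 c : 'I_q -> 'I_n, {homo c : i j / (i < j)%N} & complementary s c.
Proof.
move=> pq sh; have si := homo_ltn_inj sh.
have [|c ch cE] := @increasing_enumeration (~: (s @: 'I_p)) q.
  by rewrite cardsCs finset.setCK card_imset// !card_ord -pq addKn.
by exists c => //; split=> //; [exact: homo_ltn_inj|rewrite cE finset.setCK].
Qed.

Lemma complementaryC p q (s : 'I_p -> 'I_n) (c : 'I_q -> 'I_n) :
  complementary s c -> complementary c s.
Proof. by case=> si ci E; split=> //; rewrite E finset.setCK. Qed.

Lemma complementary_sum p q (s : 'I_p -> 'I_n) (c : 'I_q -> 'I_n)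
    (V : nmodType) (F : 'I_n -> V) : complementary s c ->
  \sum_i F i = \sum_k F (s k) + \sum_k F (c k).
Proof.
case=> si ci E.
have im r (h : 'I_r -> 'I_n) : injective h -> \sum_(i in h @: 'I_r) F i = \sum_k F (h k).
  by move=> hi; rewrite big_imset; [apply: eq_bigl|move=> ? ? _ _; exact: hi].
rewrite (bigID (mem (s @: 'I_p)))/= im// -(im _ _ ci); congr (_ + _).
by apply: eq_bigl => i; rewrite E inE negbK.
Qed.

End Complements.

(** * Complementary minors of a matrix and of its kernel *)

Section LinearAlgebra.
Variable F : fieldType.

Lemma det0_colP n (A : 'M[F]_n) :
  reflect (exists2 v : 'cV_n, v != 0 & A *m v = 0) (\det A == 0).
Proof.
rewrite -det_tr; apply: (iffP det0P) => -[v v0 Av].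
  exists v^T; first by rewrite -trmx0 (inj_eq trmx_inj).
  by apply: trmx_inj; rewrite trmx_mul trmxK trmx0.
exists v^T; first by rewrite -trmx0 (inj_eq trmx_inj).
by rewrite -trmx_mul Av trmx0.
Qed.

(* With L G = 0, vanishing of either minor means that the column space of G, which
   is the kernel of L, contains a nonzero vector supported on s. *)
Lemma complementary_minors d g (L : 'M[F]_(g, d + g)) (G : 'M[F]_(d + g, d))
    (s : 'I_g -> 'I_(d + g)) (c : 'I_d -> 'I_(d + g)) :
  complementary s c -> L *m G = 0 -> usubmx G = 1%:M -> rsubmx L \in unitmx ->
  (\det (colsub s L) == 0) = (\det (rowsub c G) == 0).
Proof.
move=> sc LG G1 Lu.
have LE (w : 'cV_(d + g)) : rowsub c w = 0 ->
    L *m w = colsub s L *m rowsub s w.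
  move=> cw; apply/colP => i; rewrite !mxE (complementary_sum _ sc) [X in _ + X]big1.
    by rewrite addr0; apply: eq_bigr => k _; rewrite !mxE.
  by move=> k _; have := congr1 (fun v : 'cV_d => v k 0) cw; rewrite !mxE => ->; rewrite mulr0.
have w0 (w : 'cV[F]_(d + g)) : rowsub c w = 0 -> rowsub s w = 0 -> w = 0.
  move=> cw sw; apply/colP => i; rewrite mxE; have [_ _ E] := sc.
  have [/imsetP[k _ ->]|] := boolP (i \in s @: 'I_g).
    by have := congr1 (fun v : 'cV_g => v k 0) sw; rewrite !mxE.
  rewrite E inE negbK => /imsetP[k _ ->].
  by have := congr1 (fun v : 'cV_d => v k 0) cw; rewrite !mxE.
(* As the top block of [G] is the identity, [w - G *m usubmx w] has zero top part; the invertible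
   right block of [L] then kills its bottom part. *)
have kerL (w : 'cV_(d + g)) : L *m w = 0 -> w = G *m usubmx w.
  move=> Lw; set v := G *m _; apply/eqP; rewrite -subr_eq0; apply/eqP.
  set x := w - v; have ux : usubmx x = 0.
    by rewrite /x linearB /= /v -mul_usub_mx G1 mul1mx subrr.
  have Lx : L *m x = 0 by rewrite /x mulmxBr Lw /v mulmxA LG mul0mx subrr.
  move: Lx; rewrite -[x]vsubmxK ux -[L]hsubmxK mul_row_col mulmx0 add0r => Lx.
  suff -> : dsubmx x = 0 by exact: col_mx0.
  by rewrite -(mulKmx Lu (dsubmx x)) Lx mulmx0.
apply/det0_colP/det0_colP => -[y y0 Ay].
  (* The extension of [y] by zero outside the image of [s]. *)
  pose w : 'cV_(d + g) := \col_i \sum_(k | s k == i) y k 0.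
  have [si ci E] := sc.
  have sw : rowsub s w = y.
    apply/colP => k; rewrite !mxE (big_pred1 k) // => k' /=.
    by rewrite (inj_eq si).
  have cw : rowsub c w = 0.
    apply/colP => k; rewrite !mxE big1// => k' /eqP sk.
    have : c k \in s @: 'I_g by rewrite -sk imset_f.
    by rewrite E inE imset_f.
  have Lw : L *m w = 0 by rewrite LE// sw.
  exists (usubmx w).
    apply: contra y0 => /eqP uw; rewrite -sw (kerL w Lw) uw mulmx0.
    by apply/eqP/colP => i; rewrite !mxE.
  by rewrite mul_rowsub_mx -(kerL w Lw).
have cw : rowsub c (G *m y) = 0 by rewrite -mul_rowsub_mx.
exists (rowsub s (G *m y)); last by rewrite -LE// mulmxA LG mul0mx.
apply: contra y0 => /eqP /(w0 _ cw) Gy.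
by rewrite -[y]mul1mx -G1 mul_usub_mx Gy linear0.
Qed.

End LinearAlgebra.

(** * Nonvanishing of a wedge product over a field *)

Section Wedge.

Lemma wedge_upd_comb (A : comNzRingType) n (V : lmodType A) (t : {ffun 'I_n -> V})
    i (I : Type) (r : seq I) (a : I -> A) (x : I -> V) :
  (forall j, wedge (upd t i (x j)) = 0) ->
  wedge (upd t i (\sum_(j <- r) a j *: x j)) = 0.
Proof.
move=> tx; elim: r => [|j r ih].
  have := wedge_lin t i 1 0 0; rewrite scaler0 addr0 scale1r big_nil.
  by move/eqP; rewrite -subr_eq subrr => /eqP <-.
by rewrite big_cons wedge_lin tx scaler0 add0r.
Qed.

(** [ext_det] gives one direction. For the other, a singular matrix has a row that is a combination
    of the remaining ones, and each resulting term repeats a row. This turns the condition in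
    [Ideal_g] into one on minors. *)
Lemma wedge_eq0 (F : fieldType) n (t : {ffun 'I_n -> 'rV[F]_n}) :
  (wedge t == 0) = (det_rows t == 0).
Proof.
apply/eqP/eqP => [t0|/eqP/det0P[v v0 vt]].
  by rewrite -ext_detE t0 (semilin0 (@ext_det_semilin F n)).
have [i vi] : exists i, v 0 i != 0.
  apply: contrapT => H; move/eqP: v0; apply; apply/rowP => i; rewrite mxE.
  by apply: contrapT => /eqP vi; apply: H; exists i.
have ti : t i = \sum_(j | j != i) (- ((v 0 i)^-1 * v 0 j)) *: t j.
  apply/rowP => k; have := congr1 (fun u : 'rV_n => u 0 k) vt.
  rewrite !mxE (bigD1 i)//= !mxE => /eqP; rewrite addr_eq0 => /eqP e.
  rewrite -(mulKf vi (t i 0 k)) e mulrN summxE mulr_sumr -sumrN.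
  by apply: eq_bigr => j ji; rewrite !mxE mulrA mulNr.
have -> : t = upd t i (\sum_(j | j != i) (- ((v 0 i)^-1 * v 0 j)) *: t j).
  by apply/ffunP => k; rewrite ffunE; case: eqP => // ->.
rewrite big_mkcond (eq_bigr (fun j => (- ((v 0 i)^-1 * v 0 j)) *: (if j != i then t j else 0))).
  apply: wedge_upd_comb => j; case: eqP => [_|/eqP ji] /=.
    (* The sum over an empty family yields the vanishing of a wedge with a zero entry. *)
    have := @wedge_upd_comb F n _ t i void [::] (fun=> 0) (fun=> 0).
    by rewrite big_nil; apply; case.
  apply: (@wedge_alt F n _ _ i j); first by rewrite eq_sym.
  by rewrite !ffunE eqxx (negbTE ji).
by move=> j _; case: eqP; rewrite ?scaler0.
Qed.

End Wedge.

(** * Generators of quotient modules, comparison of ideals, determinant of a product *)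

Section SpansAndDeterminants.

Lemma quotmod_generated (A : comNzRingType) (T : choiceType) (S : set {malg A[T]}) (q : quotmod S) :
  Defs.span (range (fun t => qpi S (mkmalgU t 1))) q.
Proof.
rewrite -[q]qreprK; set v := qrepr q.
rewrite [v]monalgE; elim: (monalg.msupp v : seq T) => [|t r ih].
  by rewrite big_nil qpi0; exact: span0.
rewrite big_cons (_ : mkmalgU _ _ = monalg.mcoeff t v *: mkmalgU t 1); last first.
  by apply/malgP => s; rewrite monalg.mcoeffZ !monalg.mcoeffU mulrnAr mulr1.
by rewrite qpi_lin; apply: span_lin => //; exists t.
Qed.

(** Lets two ideals be compared on generators when elements correspond through multiplication by
    X^gamma_0, which takes place in the fraction field. *)
Lemma ideal_rel (A : comNzRingType) (S T : set A) (P : A -> A -> Prop) :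
  P 0 0 -> (forall a x y v w, P x y -> P v w -> P (a * x + v) (a * y + w)) ->
  (forall x, S x -> exists2 y, ideal T y & P x y) ->
  forall x, ideal S x -> exists2 y, ideal T y & P x y.
Proof.
move=> P0 PL ST x; elim=> [|a u v Su _ [w Tw Pw]].
  by exists 0 => //; exact: span0.
have [y Ty Py] := ST u Su; exists (a * y + w); last exact: PL.
by apply: spanD => //; exact: (@spanZ A A^o).
Qed.

(** Cauchy-Binet before grouping: multilinearity in the rows gives a sum over all maps [f], not only
    increasing ones. *)
Lemma det_mulmx_expand (A : comNzRingType) m n (M : 'M[A]_(n, m)) (N : 'M[A]_(m, n)) :
  \det (M *m N) = \sum_(f : {ffun 'I_n -> 'I_m}) (\prod_i M i (f i)) * \det (rowsub f N).
Proof.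
rewrite /determinant.
under eq_bigr => s _.
  under eq_bigr => i _ do rewrite mxE.
  rewrite bigA_distr_bigA mulr_sumr.
  under eq_bigr => f _ do rewrite big_split /= mulrCA.
  over.
rewrite exchange_big /=; apply: eq_bigr => f _; rewrite mulr_sumr.
by apply: eq_bigr => s _; congr (_ * (_ * _)); apply: eq_bigr => i _; rewrite mxE.
Qed.

End SpansAndDeterminants.

(** * The lattices M_j, the generators of Gamma and their relations *)

Section Lattice.
Variable d : nat.
Implicit Types lam : seq 'rV[rat]_d.

(** [fset_set] is empty on an infinite set, so finiteness of the set of cosets is the point. A
    common denominator N puts N lambda_j in Z^d, and the multiples r lambda_j with r < N represent
    all cosets. *)
Lemma nidx_gt0 lam j : (0 < nidx lam j)%N.
Proof.
rewrite /nidx /index; have [N N0 NP] := Mlat_denom lam j.+1.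
have lN : Mlat lam j (lam`_j *+ N).
  apply: (@Mlat_le _ lam 0) => //.
  have /choice[z zE] := NP _ (Mlat_lam lam j).
  exists (\row_i z i); apply/rowP => i; rewrite mulmxnE zE !mxE -[LHS]mulr_natr.
  by rewrite divfK// pnatr_eq0 -lt0n.
pose coset a : set 'rV[rat]_d := [set a + b | b in Mlat lam j].
have coset_eq a b : Mlat lam j (a - b) -> coset a = coset b.
  move=> Mab; apply/seteqP; split=> _ [x Mx <-].
    exists (a - b + x); first exact: MlatD.
    by rewrite addrA (addrC b) subrK.
  exists (b - a + x); last by rewrite addrA (addrC a) subrK.
  by apply: MlatD => //; rewrite -opprB; exact: MlatN.
have fin : finite_set [set coset a | a in Mlat lam j.+1].
  apply: (@sub_finite_set _ _ ((fun r : 'I_N => coset (lam`_j *+ r)) @` setT)); last first.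
    exact/finite_image/finite_finset.
  move=> _ [_ [a Ma [z _ <-]] <-].
  have rN : (`|(z %% N%:Z)%Z| < N)%N.
    rewrite -ltz_nat gez0_abs ?modz_ge0//; first exact: ltz_pmod.
    by rewrite eqz_nat -lt0n.
  exists (Ordinal rN) => //=; apply/esym/coset_eq.
  rewrite -addrA; apply: MlatD => //.
  have -> : lam`_j *+ `|(z %% N%:Z)%Z| = lam`_j *~ (z %% N%:Z)%Z.
    by rewrite pmulrn gez0_abs ?modz_ge0// eqz_nat -lt0n.
  rewrite [in lam`_j *~ z](divz_eq z N%:Z) mulrzDr.
  rewrite addrK mulrC mulrzA -pmulrn.
  have : Mlat lam j.+1 0 by case: (Mlat_group lam j.+1).
  case: (z %/ N)%Z => n _; first exact: MlatMn.
  by apply: MlatN; exact: MlatMn.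
rewrite cardfs_gt0; apply/eqP => /(fset_set_set0 fin) e.
suff : [set coset a | a in Mlat lam j.+1] (coset 0) by rewrite e.
by exists 0 => //; case: (Mlat_group lam j.+1).
Qed.

(** In the recursion, the increment lambda_(j+1) - lambda_j is nonnegative by [prec]. *)
Lemma lbar_ge0 lam g : (forall i, (i < g)%N -> forall k, 0 <= lam`_i 0 k) ->
  (forall i j, (i < j < g)%N -> prec lam`_i lam`_j) ->
  forall j, (j < g)%N -> forall k, 0 <= lbar lam j 0 k.
Proof.
move=> l0 lP; elim=> [|j ih] jg k; first exact: l0.
rewrite /= -addrA !mxE mulmxnE addr_ge0//; first by rewrite mulrn_wge0// ih// ltnW.
by have [H _] := lP j j.+1 ltac:(by rewrite ltnSn jg); rewrite subr_ge0.
Qed.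

Lemma gam_lshift g lam (i : 'I_d) : gam lam (lshift g i) = delta_mx 0 i.
Proof. by rewrite /gam (unsplitK (inl i)). Qed.

Lemma gam_rshift g lam (j : 'I_g) : gam lam (rshift d j) = lbar lam j.
Proof. by rewrite /gam (unsplitK (inr j)). Qed.

Lemma gam_ge0 lam g : (forall j, (j < g)%N -> forall k, 0 <= lbar lam j 0 k) ->
  forall (i : 'I_(d + g)) k, 0 <= gam lam i 0 k.
Proof.
move=> l0 i k; rewrite /gam; case: splitP => [a _|j _]; last exact: l0.
by rewrite mxE ler0n.
Qed.

Definition gam_mx g lam : 'M[rat]_(d + g, d) := \matrix_i gam lam i.

Lemma usubmx_gam_mx g lam : usubmx (gam_mx g lam) = 1%:M.
Proof.
by apply/matrixP => i j; rewrite !mxE gam_lshift mxE eqxx eq_sym.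
Qed.

(** Row [j] is the difference of the exponent vectors of the two monomials of h_j; the test
    [i < d + j] mirrors the range of the product in [hpoly]. *)
Definition relation_mx g lam (ell : 'I_g -> 'I_(d + g) -> nat) : 'M[rat]_(g, d + g) :=
  \matrix_(j, i) ((if (i < d + j)%N then ell j i else 0%N)%:R
                  - (if i == rshift d j then nidx lam j else 0%N)%:R).

(** The first monomial of h_j only involves variables before U_(d+j), so this block is lower
    triangular with diagonal entries -n_j. *)
Lemma relation_mx_unit g lam ell : rsubmx (@relation_mx g lam ell) \in unitmx.
Proof.
rewrite unitmxE unitfE det_trig.
  apply/prodf_neq0 => j _; rewrite !mxE eqxx ltnn sub0r oppr_eq0 pnatr_eq0.
  by rewrite -lt0n nidx_gt0.
apply/is_trig_mxP => i j ij; rewrite !mxE ltn_add2l ltnNge (ltnW ij) /=.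
by rewrite eq_rshift (gtn_eqF ij : (j == i) = false) subrr.
Qed.

Lemma relation_sum1 g lam (ell : 'I_g -> 'I_(d + g) -> nat) (j : 'I_g) :
  normal_form lam ell ->
  \sum_i gam lam i *+ (if (i < d + j)%N then ell j i else 0%N) = lbar lam j *+ nidx lam j.
Proof.
move=> /(_ j)[-> _]; rewrite [RHS]big_mkcond; apply: eq_bigr => i _.
by case: ifP.
Qed.

Lemma relation_sum2 g lam (j : 'I_g) :
  \sum_i gam lam i *+ (if i == rshift d j then nidx lam j else 0%N) = lbar lam j *+ nidx lam j.
Proof.
rewrite (bigD1 (rshift d j))//= eqxx gam_rshift big1 ?addr0// => i ij.
by rewrite (negbTE ij).
Qed.

Lemma relation_mx_gam g lam ell : normal_form lam ell ->
  @relation_mx g lam ell *m gam_mx g lam = 0.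
Proof.
move=> ellP; apply/matrixP => j k; rewrite !mxE.
under eq_bigr => i _ do rewrite !mxE mulrBl !mulr_natl -!mulmxnE.
by rewrite sumrB -!summxE relation_sum1// relation_sum2 subrr.
Qed.

(* The exponent left after dividing X^(sum_j n_j lbar_j) by the X^gamma_i with i in s. *)
Lemma frob_complement g lam (s : 'I_g -> 'I_(d + g)) (c : 'I_d -> 'I_(d + g)) :
  complementary s c ->
  \sum_(j < g) lbar lam j *+ nidx lam j =
  \sum_k gam lam (s k) + (frob g lam + \sum_k gam lam (c k)).
Proof.
move=> sc; rewrite addrCA -(complementary_sum _ sc) /frob big_split_ord/=.
under [\sum_(i < d) gam _ _]eq_bigr => i _ do rewrite gam_lshift.
under [\sum_(i < g) gam _ _]eq_bigr => i _ do rewrite gam_rshift.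
rewrite addrA subrK -big_split/=; apply: eq_bigr => j _.
by rewrite -mulrSr prednK// nidx_gt0.
Qed.

End Lattice.

(** * The logarithmic Jacobian ideal equals I_g *)

Section MonomialIdeals.
Variables (R : realType) (d g : nat) (lam : seq 'rV[rat]_d) (k : nat).
Hypothesis k0 : (0 < k)%N.
Local Notation C := R[i].
Local Notation Q := 'rV[rat]_d.
Local Notation E := (cone (Mlat lam g)).
Local Notation S := (@sgens d g lam).
Local Notation G := (gam_mx g lam).
Local Notation OZ := (OZ R g lam).
Local Notation OS0 := (OS0 R g lam).
Local Notation gam := (@gam d g lam).
Local Notation X := (mono E (1 : C)).
Local Notation iota := (@S0Z R d g lam).
Local Notation rc := (@ratcst R d E).
Hypothesis Ek : forall a, mon_gen E a -> frac_exps k a.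
Hypothesis gamp : forall i j, 0 <= gam i 0 j.

Lemma gam_cone i : mon_gen E (gam i).
Proof. by apply: sub_mon_gen; split; [exact: Mlat_gam|exact: gamp]. Qed.

Lemma sgens_cone a : mon_gen S a -> mon_gen E a.
Proof.
by elim=> [|x y [i _ <-] _ ih]; [left|apply: mon_genD ih; exact: gam_cone].
Qed.

Lemma dlog_mono u a : mon_gen E a -> dlog u (X a) = rc (lform u a) * X a.
Proof.
move=> Ea; apply: cpsP => e.
rewrite dlogE cps_const_coef !(mono_coef k0 Ek)//.
by case: eqP => [->|]; rewrite ?mulr0.
Qed.

(** The generators that can be subtracted from [a] inside Gamma. There are finitely many values, so
    they cut the support of a series into finitely many pieces. *)
Definition steps (a : Q) : {set 'I_(d + g)} :=
  [set i | `[< mon_gen S (a - gam i) >]]%SET.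

(** Rows outside [T] are zeroed rather than removed, so that coordinates have the same index type
    for all [T]. *)
Definition rows_in (T : {set 'I_(d + g)}) : 'M[rat]_(d + g, d) :=
  \matrix_i (if i \in T then gam i else 0).

(** Each generator occurring in an expression of [a] as a sum is a step of [a], so its row is
    present. *)
Lemma steps_span a (T : {set 'I_(d + g)}) : mon_gen S a ->
  (forall i, mon_gen S (a - gam i) -> i \in T) -> (a <= rows_in T)%MS.
Proof.
move=> Sa; elim: Sa => [|x y [i _ <-] Sy ih] HT; first exact: sub0mx.
apply: addmx_sub; last first.
  by apply: ih => j Sj; apply: HT; rewrite -addrA; apply: mon_gen_add => //; exists i.
have iT : i \in T by apply: HT; rewrite addrAC subrr add0r.
by rewrite (_ : gam i = row i (rows_in T)) ?row_sub// rowK iT.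
Qed.

(* Splitting f according to the steps available from an exponent makes the
   coordinates of the exponent on the generators linear on each piece; the h i are
   then quotients of logarithmic derivatives of the pieces, and so converge. *)
Lemma dlog_decomposition (f : OS0) : exists h : 'I_(d + g) -> OZ,
  forall u, dlog u (iota f) = \sum_i rc (lform u (gam i)) * X (gam i) * h i.
Proof.
set F := iota f.
have FS a : F a != 0 -> mon_gen S a by exact: (cps_supp (f := f)).
pose FT T := restr F [set a | steps a = T].
(* Column [i] of the pseudo-inverse is the linear form giving the i-th coordinate of an exponent on
   the rows of [rows_in T]. *)
pose D T i := dlog (col i (pinvmx (rows_in T))) (FT T).
have hP (T : {set 'I_(d + g)}) (i : 'I_(d + g)) :
    exists h : cps R E, i \in T -> D T i = X (gam i) * h.
  have [iT|] := boolP (i \in T); last by exists 0.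
  (* Every exponent [b] of the piece has [i] among its steps, so [b - gam i] stays in Gamma. *)
  have [|h hE] := mono_divides k0 Ek (gam_cone i) (f := D T i); last by exists h.
  move=> b; rewrite /D dlogE restrE; case: ifP => [/asboolP /= bT|]; last by rewrite mulr0 eqxx.
  rewrite mulf_eq0 negb_or => /andP[_ _].
  by move: iT; rewrite -bT inE => /asboolP /sgens_cone.
have /choice[H HP] : forall T : {set 'I_(d + g)},
    exists h : 'I_(d + g) -> cps R E, forall i, i \in T -> D T i = X (gam i) * h i.
  by move=> T; have /choice[h hh] := hP T; exists h.
exists (fun i => \sum_(T : {set 'I_(d + g)} | i \in T) H T i) => u.
rewrite {1}(@restr_partition R d E _ steps F) dlog_sum.
under [RHS]eq_bigr => i _ do rewrite mulr_sumr.
rewrite [RHS](exchange_big_dep xpredT)//=; apply: eq_bigr => T _.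
under eq_bigr => i iT do rewrite -mulrA -HP//.
rewrite -/(FT T); apply: cpsP => a; rewrite cps_coef_sum dlogE.
under eq_bigr => i _ do rewrite cps_const_coef dlogE mulrA.
rewrite -mulr_suml; have [->|Fa] := eqVneq (FT T a) 0; first by rewrite !mulr0.
congr (_ * _); move: Fa; rewrite restrE; case: ifP => [/asboolP /= aT Fa|]; last by rewrite eqxx.
have /mulmxKpV aE : (a <= rows_in T)%MS.
  apply: steps_span; first exact: FS.
  by move=> i Si; rewrite -aT inE; apply/asboolP.
under eq_bigr => i _ do rewrite -rmorphM/=.
rewrite -(rmorph_sum (@ratr C))/=; congr ratr.
rewrite -{1}aE /lform -(mulmxA _ _ u) mxE [RHS]big_mkcond; apply: eq_bigr => i _.
rewrite mulrC; move: (pinvmx _) => P.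
have -> : (a *m P) 0 i = (a *m col i P) 0 0.
  by rewrite !mxE; apply: eq_bigr => j _; rewrite mxE.
have -> : (rows_in T *m u) i 0 = if i \in T then (gam i *m u) 0 0 else 0.
  rewrite !mxE; case: ifP => iT; first by apply: eq_bigr => j _; rewrite !mxE iT.
  by rewrite big1// => j _; rewrite !mxE iT mxE mul0r.
by case: ifP => _ //; rewrite mul0r.
Qed.

Local Notation Om := (OmegaS0Z (R := R) (g := g) (lam := lam)).

(** Follows from [dlog_decomposition] by semilinearity, the differentials being generators. As [h]
    does not depend on [j], the whole row is a combination of the rows of the generators. *)
Lemma eta_decomposition (b : 'M[rat]_d) (w : OmegaS0 R g lam) :
  exists h : 'I_(d + g) -> OZ, forall j,
    Defs.eta b (Om w) 0 j = \sum_i h i * (rc (lform (col j (invmx b)) (gam i)) * X (gam i)).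
Proof.
elim: (quotmod_generated w) => [|a _ v [f _ <-] _ [h hE]].
  exists (fun=> 0) => j.
  rewrite (semilin0 (@OmegaS0Z_semilin R d g lam)) (semilin0 (@eta_semilin R d g lam b)).
  by rewrite mxE big1// => i _; rewrite mul0r.
have [h' h'E] := dlog_decomposition f.
exists (fun i => iota a * h' i + h i) => j.
set e := qpi _ _.
have -> : Om (a *: e + v) = iota a *: dZ (iota f) + Om v.
  by rewrite -OmegaS0Z_d; exact: OmegaS0Z_semilin.
have -> : Defs.eta b (iota a *: dZ (iota f) + Om v) =
    iota a *: dlogs b (iota f) + Defs.eta b (Om v).
  by rewrite -eta_d; exact: eta_semilin.
rewrite mxE hE mxE mxE h'E mulr_sumr -big_split/=.
by apply: eq_bigr => i _; rewrite [RHS]mulrDl -[in RHS]mulrA [h' i * _]mulrC.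
Qed.

(** The matrix is a diagonal matrix of monomials times a constant matrix. *)
Lemma det_log_monomials (b : 'M[rat]_d) (f : 'I_d -> 'I_(d + g)) :
  \det (\matrix_(i, j) (rc (lform (col j (invmx b)) (gam (f i))) * X (gam (f i)))) =
  rc (\det (rowsub f G) * \det (invmx b)) * X (\sum_i gam (f i)).
Proof.
rewrite -det_mulmx -det_map_mx.
have [<- _] := mono_prod R k0 Ek (index_enum 'I_d) (fun i => gam_cone (f i)).
rewrite (_ : \matrix_(i, j) _ = diag_mx (\row_i X (gam (f i))) *m
    map_mx rc (rowsub f G *m invmx b)).
  rewrite det_mulmx det_diag mulrC; congr (_ * _).
  by apply: eq_bigr => i _; rewrite mxE.
apply/matrixP => i j; rewrite mul_diag_mx !mxE mulrC; congr (_ * rc _).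
by rewrite /lform mxE; apply: eq_bigr => l _; rewrite !mxE.
Qed.

(** A nonzero minor forces [f] to be injective; sorting [f] keeps the sum and changes the minor by a
    sign only. *)
Lemma mono_in_Ideal_g (f : 'I_d -> 'I_(d + g)) : \det (rowsub f G) != 0 ->
  Ideal_g R g lam (X (\sum_i gam (f i))).
Proof.
move=> fG; have fi : injective f.
  move=> i j fij; apply/eqP; apply: contraNT fG => ij; apply/eqP.
  by apply: (determinant_alternate ij) => l; rewrite !mxE fij.
have [s [t [sh st]]] := increasing_rearrangement fi.
have -> : \sum_i gam (f i) = \sum_i gam (s i).
  by rewrite [RHS](reindex_inj (@perm.perm_inj _ t)); apply: eq_bigr => i _; rewrite st.
apply: (@Defs.sub_span _ OZ^o); exists s; split=> //.
rewrite wedge_eq0 /det_rows; apply: contra fG => /eqP sG.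
have -> : rowsub f G = row_perm t (rowsub s G).
  by apply/matrixP => i j; rewrite !mxE st.
rewrite row_permE det_mulmx (_ : rowsub s G = \matrix_(i, j) [ffun i0 => gam (s i0)] i 0 j).
  by rewrite sG mulr0.
by apply/matrixP => i j; rewrite !mxE ffunE.
Qed.

Lemma logmap_in_Ideal_g (b : 'M[rat]_d) (w : extpow d (OmegaS0 R g lam)) :
  Ideal_g R g lam (logmap b w).
Proof.
elim: (quotmod_generated w) => [|a _ v [t _ <-] _ ih].
  rewrite /logmap (semilin0 (ext_map_semilin (@OmegaS0Z_semilin R d g lam))).
  rewrite (semilin0 (ext_map_semilin (@eta_semilin R d g lam b))).
  by rewrite (semilin0 (@ext_det_semilin _ _)); exact: span0.
rewrite logmap_semilin; apply: spanD ih; apply: (@spanZ _ OZ^o).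
rewrite /logmap -/(wedge t) (ext_mapE (@OmegaS0Z_semilin R d g lam)).
rewrite (ext_mapE (@eta_semilin R d g lam b)) ext_detE /det_rows.
have /choice[h hE] := fun i => eta_decomposition b (t i).
(* Factoring through the matrix of all generators reduces the determinant to those of
   [det_log_monomials]. *)
rewrite (_ : \matrix_(i, j) _ = (\matrix_(i, l) h i l) *m
    \matrix_(l, j) (rc (lform (col j (invmx b)) (gam l)) * X (gam l))); last first.
  by apply/matrixP => i j; rewrite !mxE !ffunE hE; apply: eq_bigr => l _; rewrite !mxE.
rewrite det_mulmx_expand; apply: (big_ind (Ideal_g R g lam)) => [|x y|f _].
- exact: span0.
- exact: spanD.
rewrite (_ : rowsub f _ =
    \matrix_(i, j) (rc (lform (col j (invmx b)) (gam (f i))) * X (gam (f i)))).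
  rewrite det_log_monomials mulrA; have [->|fG] := eqVneq (\det (rowsub f G)) 0.
    by rewrite mul0r rmorph0 mulr0 mul0r; exact: span0.
  by apply: (@spanZ _ OZ^o); exact: mono_in_Ideal_g.
by apply/matrixP => i j; rewrite !mxE.
Qed.

Lemma iota_mono a : mon_gen S a -> iota (mono S 1 a) = X a.
Proof.
move=> Sa; apply: cpsP => e; rewrite (mono_coef k0 Ek)//; last exact: sgens_cone.
rewrite -[LHS]/(mono S (1 : C) a e) (mono_coef k0)// => c /sgens_cone; exact: Ek.
Qed.

Lemma Jlog_eq_Ideal_g (b : 'M[rat]_d) : b \in unitmx -> Jlog R g lam b = Ideal_g R g lam.
Proof.
move=> bu; apply/seteqP; split=> x.
  elim=> [|a _ v [w _ <-] _ ih]; first exact: span0.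
  by apply: spanD ih; apply: (@spanZ _ OZ^o); exact: logmap_in_Ideal_g.
elim=> [|a _ v [s [sh sw ->]] _ ih]; [exact: span0|apply: spanD ih].
apply: (@spanZ _ OZ^o).
(* The constant of [det_log_monomials]; being nonzero, it is inverted to recover the monomial from
   the wedge of the dX^(gamma_i). *)
set D := \det (rowsub s G) * \det (invmx b).
have D0 : D != 0.
  rewrite mulf_neq0//; last by rewrite -unitfE -unitmxE unitmx_inv.
  move: sw; rewrite wedge_eq0 /det_rows; congr (_ != 0); congr (\det _).
  by apply/matrixP => i j; rewrite !mxE ffunE.
rewrite (_ : X _ = rc D^-1 * (rc D * X (\sum_i gam (s i)))); last first.
  by rewrite mulrA -rmorphM mulVf// rmorph1 mul1r.
apply: (@spanZ _ OZ^o); rewrite -det_log_monomials.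
apply: (@Defs.sub_span _ OZ^o); exists (wedge [ffun i => dS0 (mono S 1 (gam (s i)))]) => //.
rewrite logmap_wedge; congr (\det _); apply/matrixP => i j; rewrite !mxE.
rewrite iota_mono; last by apply: sub_mon_gen; exists (s i).
by rewrite dlog_mono//; exact: gam_cone.
Qed.

(** * Minors of the Jacobian matrix *)

Local Notation ev := (@evU R d g lam).
Local Notation frob := (frob g lam).

(** Exhibits the coefficient map as the ring morphism [cps_const], so that evaluation is one too. *)
Lemma evU_mmap p : ev p = mmap (@cps_const R d E) (fun i => X (gam i)) p.
Proof. by []. Qed.

Lemma evU_B (p q : mpoly (d + g) C) : ev (p - q) = ev p - ev q.
Proof. by rewrite (evU_mmap (p - q)) mmapB -(evU_mmap p) -(evU_mmap q). Qed.

Lemma evU_mpolyX (m : 'X_{1.. d + g}) :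
  ev 'X_[m] = X (\sum_i gam i *+ m i) /\ mon_gen E (\sum_i gam i *+ m i).
Proof.
have Em i : mon_gen E (gam i *+ m i) by have [] := mono_exp R k0 Ek (m i) (gam_cone i).
have [e1 e2] := mono_prod R k0 Ek (index_enum 'I_(d + g)) Em; split=> //.
rewrite -e1 evU_mmap mmapX /mmap1; apply: eq_bigr => i _.
by have [-> _] := mono_exp R k0 Ek (m i) (gam_cone i).
Qed.

Lemma evU_log_deriv (m : 'X_{1.. d + g}) i :
  X (gam i) * ev (mderiv i 'X_[m]) = rc (m i)%:R * X (\sum_l gam l *+ m l).
Proof.
rewrite mderivX evU_mmap mmapZ -evU_mmap mulrCA !rmorph_nat.
(* If [m i] is 0, the subtraction [m - U_(i)] is truncated, but both sides vanish. *)
have [mi|mi] := posnP (m i); first by rewrite mi !mul0r.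
have [-> Em] := evU_mpolyX (m - U_(i)); rewrite (mono_mul k0 Ek)//; last exact: gam_cone.
rewrite mulr1; congr (_ * X _).
rewrite (bigD1 i)//= [RHS](bigD1 i)//= addrA; congr (_ + _).
  by rewrite mnmBE mnm1E eqxx -mulrS subn1 prednK.
by apply: eq_bigr => l li; rewrite mnmBE mnm1E eq_sym (negbTE li) subn0.
Qed.

(** Both monomials of h_j evaluate to X^(n_j lbar_j), so only the difference of their exponents in
    U_i remains as a factor. *)
Lemma hpoly_log_deriv ell (j : 'I_g) i : normal_form lam ell ->
  X (gam i) * ev (mderiv i (hpoly R lam ell j)) =
  rc (relation_mx lam ell j i) * X (lbar lam j *+ nidx lam j).
Proof.
move=> ellP.
pose m1 := [multinom (if (l < d + j)%N then ell j l else 0%N) | l < d + g].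
pose m2 := [multinom (if l == rshift d j then nidx lam j else 0%N) | l < d + g].
have -> : hpoly R lam ell j = 'X_[m1] - 'X_[m2].
  rewrite !mpolyXE_id /hpoly; congr (_ - _).
    rewrite big_mkcond; apply: eq_bigr => l _; rewrite mnmE.
    by case: ifP => _; rewrite ?expr0.
  rewrite (bigD1 (rshift d j))//= mnmE eqxx big1 ?mulr1// => l lj.
  by rewrite mnmE (negbTE lj) expr0.
have m1E : \sum_l gam l *+ m1 l = lbar lam j *+ nidx lam j.
  by rewrite -(relation_sum1 j ellP); apply: eq_bigr => l _; rewrite mnmE.
have m2E : \sum_l gam l *+ m2 l = lbar lam j *+ nidx lam j.
  by rewrite -(relation_sum2 lam j); apply: eq_bigr => l _; rewrite mnmE.
rewrite mderivB evU_B mulrBr.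
apply: etrans (congr2 (fun x y => x - y) (evU_log_deriv m1 i) (evU_log_deriv m2 i)) _.
by rewrite m1E m2E -mulrBl -rmorphB !mnmE mxE.
Qed.

Lemma lbar_multiple_cone (j : 'I_g) : mon_gen E (lbar lam j *+ nidx lam j).
Proof.
rewrite -(@gam_rshift d g).
by have [] := mono_exp R k0 Ek (nidx lam j) (gam_cone (rshift d j)).
Qed.

(** Scaling column l by X^(gamma_(s l)) turns row j into X^(n_j lbar_j) times constants; both
    scalings are diagonal matrices. *)
Lemma jac_minor ell (s : 'I_g -> 'I_(d + g)) : normal_form lam ell ->
  X (\sum_j gam (s j)) * ev (\det (colsub s (jacmx R lam ell))) =
  rc (\det (colsub s (relation_mx lam ell))) * X (\sum_(j < g) lbar lam j *+ nidx lam j).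
Proof.
move=> ellP.
have [<- _] := mono_prod R k0 Ek (index_enum 'I_g) (fun j => gam_cone (s j)).
have [<- _] := mono_prod R k0 Ek (index_enum 'I_g) lbar_multiple_cone.
have -> : ev (\det (colsub s (jacmx R lam ell))) = \det (map_mx ev (colsub s (jacmx R lam ell))).
  exact/esym/(det_map_mx (mmap (@cps_const R d E) (fun i => X (gam i)))).
rewrite -det_map_mx.
have dE (F : 'I_g -> cps R E) : \prod_j F j = \det (diag_mx (\row_j F j)).
  by rewrite det_diag; apply: eq_bigr => j _; rewrite mxE.
rewrite !dE mulrC [RHS]mulrC -!det_mulmx; congr (\det _); apply/matrixP => j l.
by rewrite mul_mx_diag mul_diag_mx !mxE mulrC hpoly_log_deriv// mulrC !mxE.
Qed.

Lemma jac_generator ell (s : 'I_g -> 'I_(d + g)) (c : 'I_d -> 'I_(d + g)) :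
  normal_form lam ell -> complementary s c ->
  if \det (rowsub c G) == 0 then ev (\det (colsub s (jacmx R lam ell))) = 0
  else exists q : rat, [/\ q != 0, mon_gen E (frob + \sum_i gam (c i)) &
    ev (\det (colsub s (jacmx R lam ell))) = rc q * X (frob + \sum_i gam (c i))].
Proof.
move=> ellP sc; have := jac_minor s ellP; rewrite (frob_complement lam sc).
have [_ Es] := mono_prod R k0 Ek (index_enum 'I_g) (fun j => gam_cone (s j)).
have X0 := mono_neq0 R k0 Ek Es.
rewrite -(complementary_minors sc (relation_mx_gam ellP)
  (usubmx_gam_mx g lam) (relation_mx_unit lam ell)).
set q := \det (colsub s (relation_mx lam ell)); set y := ev _; have [->|q0] := eqVneq q 0.
  by rewrite rmorph0 mul0r => /eqP; rewrite mulf_eq0 (negbTE X0) => /eqP.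
set e := frob + _ => yE.
have Ese : mon_gen E (\sum_j gam (s j) + e).
  rewrite -frob_complement//.
  by have [] := mono_prod R k0 Ek (index_enum 'I_g) lbar_multiple_cone.
have rX : rc q * X (\sum_j gam (s j) + e) = mono E (ratr q) (\sum_j gam (s j) + e).
  apply: cpsP => a; rewrite cps_const_coef !(mono_coef k0 Ek)//.
  by case: eqP; rewrite ?mulr1 ?mulr0.
(* The minor is a series in which X^e occurs, so [e] is in the cone although gamma_0 may have
   negative coordinates. *)
have Ee : mon_gen E e.
  by apply: (mono_quotient k0 Ek Es Ese _ (etrans yE rX)); rewrite fmorph_eq0.
exists q; split; [exact: q0|exact: Ee|apply: (mulfI X0)].
apply: (etrans yE); rewrite [RHS]mulrCA; congr (_ * _).
by rewrite (mono_mul k0 Ek)// mulr1.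
Qed.

(** * Multiplication by X^gamma_0 in the fraction field *)

Lemma fmono_mul a m : Mlat lam g a -> mon_gen E m -> mon_gen E (a + m) ->
  fmono R g lam a * tofrac (X m : OZ) = tofrac (X (a + m) : OZ).
Proof.
move=> Ma Em Eam; rewrite /fmono; set u := const_mx _.
have Eu : mon_gen E u.
  apply: sub_mon_gen; split=> [|i]; last by rewrite mxE ler0n.
  apply: (@Mlat_le _ lam 0) => //; exists (const_mx (\sum_i `|numq (a 0%R i)|)%N%:Z).
  by apply/rowP => i; rewrite !mxE.
have Eau : mon_gen E (a + u).
  apply: sub_mon_gen; split=> [|i]; first by apply: MlatD => //; case: (Mlat_cone Eu).
  (* A rational number is at least minus the absolute value of its numerator, which is a summand of
     the entries of [u]. *)
  rewrite !mxE -lerBlDl sub0r; apply: (@le_trans _ _ (`|numq (a 0%R i)|%N%:R)).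
    rewrite -[a 0 i in leLHS]divq_num_den -mulNr ler_pdivrMr ?ltr0z ?denq_gt0//.
    apply: (@le_trans _ _ (`|numq (a 0%R i)|%N%:R)).
      by rewrite pmulrn abszE -mulrNz ler_int -normrN ler_norm.
    by rewrite ler_peMr ?ler0n// ler1z -gtz0_ge1 denq_gt0.
  by rewrite ler_nat (bigD1 i)//= leq_addr.
have X0 : tofrac (X u : OZ) != 0
  by rewrite tofrac_eq0; apply/eqP; exact: (elimN eqP (mono_neq0 R k0 Ek Eu)).
have XE : X m * X (a + u) = X (a + m) * X u.
  by rewrite !(mono_mul k0 Ek)// addrCA addrA.
apply: (mulIf X0); rewrite mulrAC (divfK X0) mulrC.
by rewrite -[LHS]tofracM -[RHS]tofracM XE.
Qed.

Lemma frob_Mlat : Mlat lam g frob.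
Proof.
have sumM (I : Type) (r : seq I) (F : I -> Q) : (forall i, Mlat lam g (F i)) ->
    Mlat lam g (\sum_(i <- r) F i).
  move=> FM; apply: big_ind => [|x y|i _]; [by case: (Mlat_group lam g)|exact: MlatD|exact: FM].
apply: MlatD.
  by apply: sumM => j; apply: MlatMn; rewrite -gam_rshift; exact: Mlat_gam.
by apply: MlatN; apply: sumM => i; rewrite -(gam_lshift g lam); exact: Mlat_gam.
Qed.

Lemma Jac_eq_frob_Ideal_g ell : normal_form lam ell ->
  [set tofrac x | x in Jac R g lam ell] =
  [set fmono R g lam frob * tofrac y | y in Ideal_g R g lam].
Proof.
move=> ellP.
have cE (c : 'I_d -> 'I_(d + g)) : mon_gen E (\sum_i gam (c i)).
  by have [] := mono_prod R k0 Ek (index_enum 'I_d) (fun i => gam_cone (c i)).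
have wE (c : 'I_d -> 'I_(d + g)) :
    (wedge [ffun i => gam (c i)] != 0 :> extpow d Q) = (\det (rowsub c G) != 0).
  rewrite wedge_eq0 /det_rows; congr (\det _ != 0).
  by apply/matrixP => i j; rewrite !mxE ffunE.
apply/seteqP; split=> _ [x Jx <-].
  pose P (x y : OZ) := fmono R g lam frob * tofrac y = tofrac x.
  suff [y Iy Py] : exists2 y, Ideal_g R g lam y & P x y by exists y.
  move: Jx; apply: (@ideal_rel OZ _ _ P); first by rewrite /P tofrac0 mulr0.
    by move=> a u y v w; rewrite /P !tofracD !tofracM mulrDr mulrCA => -> ->.
  move=> _ [s sh ->]; have [c ch sc] := complement_exists (addnC g d) sh.
  have := jac_generator ellP sc; case: ifPn => [_ ->|c0 [q [q0 Ee ->]]].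
    by exists 0; [exact: span0|rewrite /P tofrac0 mulr0].
  exists (rc q * X (\sum_i gam (c i))).
    apply: (@spanZ _ OZ^o); apply: (@Defs.sub_span _ OZ^o).
    by exists c; rewrite wE.
  rewrite /P tofracM [in RHS]tofracM mulrCA; congr (_ * _).
  by apply: fmono_mul => //; exact: frob_Mlat.
pose P (y x : OZ) := tofrac x = fmono R g lam frob * tofrac y.
suff [y Jy Py] : exists2 y, Jac R g lam ell y & P x y by exists y.
move: Jx; apply: (@ideal_rel OZ _ _ P); first by rewrite /P tofrac0 mulr0.
  by move=> a u y v w; rewrite /P !tofracD !tofracM mulrDr mulrCA => -> ->.
move=> _ [c [ch cw ->]]; have [s sh /complementaryC sc] := complement_exists (erefl (d + g)%N) ch.
have := jac_generator ellP sc; rewrite -[_ == 0]negbK -wE cw /= => -[q [q0 Ee yE]].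
(* The Jacobian minor on the complement of [c], divided by its nonzero constant. *)
exists (rc q^-1 * (rc q * X (frob + \sum_i gam (c i)))).
  by apply: (@spanZ _ OZ^o); apply: (@Defs.sub_span _ OZ^o); exists s.
rewrite /P mulrA -rmorphM mulVf// rmorph1 mul1r fmono_mul//; exact: frob_Mlat.
Qed.

End MonomialIdeals.

(** * Characteristic exponents and conclusion *)

Lemma char_exps_ge0 (R : realType) d (f : {poly CX R d 1}) a i :
  char_exps f a -> 0 <= a 0 i.
Proof.
set n := (size f).-1; move=> [z1 [z2 [_ _ zz [u _ zE]]]].
(* [mono] is 0 by default at an exponent outside the ring; distinct roots exclude this, so [a] is a
   genuine exponent. *)
have : z1 - z2 != 0 by rewrite subr_eq0; apply/eqP.
rewrite zE mulf_eq0 negb_or => /andP[m0 _].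
have [c mc] : exists c, mono (@frac_exps d n) (1 : R[i]) a c != 0.
  apply: contrapT => H; move/eqP: m0; apply; apply: cpsP => c.
  by apply: contrapT => /eqP mc; apply: H; exists c.
have [[k k0 fk] _] := pser_puiseux (mono (@frac_exps d n) (1 : R[i]) a).
suff ca : c = a by apply: (@frac_exps_ge0 _ k); rewrite -ca; exact: fk.
move: mc; rewrite /mono /insubd; case: insubP => [v _ ->|_]; last by rewrite eqxx.
rewrite /pmono /insubd; case: insubP => [w _ /= ->|_]; last by rewrite eqxx.
by case: (c =P a) => // _; rewrite eqxx.
Qed.

Theorem mainTheorem4 (R : realType) (d : nat) (d_gt0 : (0 < d)%N)
    (f : {poly CX R d 1}) (f_qo : quasi_ordinary f) (f_irr : irreducible_elt f)
    (g : nat) (lam : g.-tuple 'rV[rat]_d) (lamP : char_exps_labelling f lam)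
    (ell : 'I_g -> 'I_(d + g) -> nat) (ellP : normal_form lam ell)
    (b : 'M[rat]_d) (bP : zbasis b (Mlat lam g)) :
  [set tofrac x | x in Jac R g lam ell] =
    [set fmono R g lam (frob g lam) * tofrac y | y in Jlog R g lam b] /\
  [set fmono R g lam (frob g lam) * tofrac y | y in Jlog R g lam b] =
    [set fmono R g lam (frob g lam) * tofrac y | y in Ideal_g R g lam].
Proof.
have [k k0 Ek] := cone_frac lam g; have [lamE lam_prec] := lamP.
have l0 i : (i < g)%N -> forall j, 0 <= lam`_i 0 j.
  move=> ig j; apply: (@char_exps_ge0 _ _ f); rewrite -lamE /=.
  by rewrite mem_nth// size_tuple.
have gamp := gam_ge0 (lbar_ge0 l0 lam_prec).
(* With J_log replaced by I_g, the second equality is reflexivity and the first compares Jac with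
   I_g. *)
have [bu _] := bP; rewrite (Jlog_eq_Ideal_g R k0 Ek gamp bu).
split; last by [].
by have := Jac_eq_frob_Ideal_g R k0 Ek gamp ellP.
Qed.
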